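(* Suppose $A_1,\dots,A_n\in\mathbb{R}^{d_1\times d_2}$ are generated from the low rank mixture model $A_i=M_{s_i^*}+E_i$, $i\in[n]$ (described in the context), with $d:=d_1d_2$. Let $(X_1^*,\dots,X_n^* )$ be the solution of the low rank convex clustering (lrCC) problem with data $A_1,\dots,A_n$, parameters $\gamma_1,\gamma_2>0$, graph $\mathcal{G}=([n],\mathcal{E})$ and weights $w_{ij}$. Let $t>0$ and $\alpha\in[K]$, and define $$\mathcal{I}_{\alpha,t}:=\{i\in[n]\mid \|A_i-M_\alpha\|_F\le t\sigma\},\qquad \eta_{ij}^{(\alpha,t)}:=\frac{1}{w_{ij}}\sum_{m\in[n]\setminus\mathcal{I}_{\alpha,t}}|w_{im}-w_{jm}|\quad (i,j\in\mathcal{I}_{\alpha,t},\ i\ne j).$$ Let $F(\cdot\,;d)$ be the cumulative distribution function of the chi distribution with $d$ degrees of freedom, and let $\epsilon\in(0,F(t;d)\pi_\alpha)$. (i) With probability at least $1-\exp(-2\epsilon^2n)$, the observations in $\mathcal{I}_{\alpha,t}$ are assigned to the same cluster (i.e. $X_i^*=X_j^*$ for all $i,j\in\mathcal{I}_{\alpha,t}$) if the following two conditions hold: (a1) the induced subgraph of $\mathcal{G}$ on $\mathcal{I}_{\alpha,t}$ is a clique, and $\eta_{ij}^{(\alpha,t)}<(F(t;d)\pi_\alpha-\epsilon)n$ for all $i,j\in\mathcal{I}_{\alpha,t}$ with $i\ne j$; (b1) for all $i,j\in\mathcal{I}_{\alpha,t}$ with $i\neq j$, $\displaystyle\gamma_1\ge\frac{2t\sigma}{w_{ij}\big((F(t;d)\pi_\alpha-\epsilon)n-\eta_{ij}^{(\alpha,t)}\big)}$.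 (ii) Let $\beta\in[K]$ with $\beta\ne\alpha$ and define $\mathcal{I}_{\beta,t}$ analogously, i.e. $\mathcal{I}_{\beta,t}:=\{i\in[n]\mid\|A_i-M_\beta\|_F\le t\sigma\}$. Then with probability at least $$\big(1-\exp(-2\epsilon^2n)-2^{-(F(t;d)\pi_\alpha-\epsilon)n}\big)\big(1-\exp(-2\epsilon^2n)-2^{-(F(t;d)\pi_\beta-\epsilon)n}\big),$$ there exist $i\in\mathcal{I}_{\alpha,t}$ and $j\in\mathcal{I}_{\beta,t}$ such that $A_i$ and $A_j$ are assigned to different clusters (i.e. $X_i^*\neq X_j^*$) if (c1) $\displaystyle \gamma_1(n-1)\widetilde{w}_{\max}+\gamma_2\sqrt{d_2}<\tfrac12\|M_\alpha-M_\beta\|_F$, where $\widetilde{w}_{\max}:=\max_{l(i,j)\in\mathcal{E}}w_{ij}$. Namely, $\mathcal{I}_{\alpha,t}$ and $\mathcal{I}_{\beta,t}$ will not be in the same cluster.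
   Context: $[n]=\{1,\dots,n\}$; $\|\cdot\|_F$ is the Frobenius norm and $\|\cdot\|_*$ the nuclear norm. Assume $d_1\ge d_2$. Low rank mixture model: $M_1,\dots,M_K\in\mathbb{R}^{d_1\times d_2}$ are deterministic, unknown low rank mean matrices, $\pi_1,\dots,\pi_K$ are mixture weights, and $A_1,\dots,A_n$ are i.i.d. samples from the mixture of $K$ Gaussians with means $M_1,\dots,M_K$, mixture weights $\pi_1,\dots,\pi_K$ and isotropic covariance $\sigma^2I_d$, $d=d_1d_2$, $\sigma>0$. That is, $A_i=M_{s_i^*}+E_i$, where the latent label $s_i^*\in[K]$ satisfies $\mathbb{P}(s_i^*=k)=\pi_k$ for $k\in[K]$, and the entries of the noise matrices $E_i$ are i.i.d. Gaussian with mean zero and variance $\sigma^2$. $\mathcal{G}=([n],\mathcal{E})$ is an undirected graph on $[n]$, $l(i,j)\in\mathcal{E}$ denotes the edge joining $i$ and $j$, each edge has a positive weight $w_{ij}=w_{ji}>0$, and $w_{ij}=0$ if $l(i,j)\notin\mathcal{E}$. The lrCC problem is $$\min_{X_1,\dots,X_n\in\mathbb{R}^{d_1\times d_2}}\ \frac12\sum_{i=1}^n\|X_i-A_i\|_F^2+\gamma_1\sum_{l(i,j)\in\mathcal{E}}w_{ij}\|X_i-X_j\|_F+\gamma_2\sum_{i=1}^n\|X_i\|_*,$$ where each edge is counted once; it has a unique optimal solution $(X_1^*,\dots,X_n^* )$. Observations $A_i$ and $A_j$ are assigned to the same cluster if and only if $X_i^*=X_j^*$.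
   Formalization: In part (ii) the bound is asserted only when at least one of the two factors of the product is nonnegative; if both are negative their product is positive and the claim can fail (e.g. n = 1, small epsilon, well-separated means, where the event has probability 0). *)

(* Defs.v *)
From HB Require Import structures.
From mathcomp Require Import all_boot all_order all_algebra.
From mathcomp Require Import spectral complex.
From mathcomp Require Import all_classical all_reals all_analysis.
From mathcomp Require Import measurable_realfun.

Set Implicit Arguments.
Unset Strict Implicit.
Unset Printing Implicit Defensive.

Import Order.TTheory GRing.Theory Num.Theory.
Import numFieldNormedType.Exports.

Local Open Scope classical_set_scope.
Local Open Scope ring_scope.

Definition frobenius_norm (R : realType) (d1 d2 : nat) (X : 'M[R]_(d1, d2)) : R :=
  Num.sqrt (\sum_(a < d1) \sum_(b < d2) X a b ^+ 2).

(* The singular values of X, with multiplicity (and padded by zeros when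
   d1 < d2), are the square roots of the eigenvalues of the positive
   semidefinite matrix X^T X.  [spectral_diag] is stated over a closed field,
   hence the detour through R[i]; the eigenvalues are real. *)
Definition nuclear_norm (R : realType) (d1 d2 : nat) (X : 'M[R]_(d1, d2)) : R :=
  \sum_(j < d2)
    Num.sqrt (complex.Re
      (spectral_diag (map_mx (real_complex R) (X^T *m X)) 0 j)).

Record weighted_graph (R : realType) (n : nat)
    (e : rel 'I_n) (w : 'I_n -> 'I_n -> R) : Prop := WeightedGraph {
  wg_sym : symmetric e;
  wg_irr : irreflexive e;
  wg_wsym : forall i j, w i j = w j i;
  wg_pos : forall i j, e i j -> 0 < w i j;
  wg_zero : forall i j, ~~ e i j -> w i j = 0 }.

(* 0 when the graph has no edge. *)
Definition max_weight (R : realType) (n : nat)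
    (e : rel 'I_n) (w : 'I_n -> 'I_n -> R) : R :=
  \big[Num.max/0]_(l : 'I_n * 'I_n | e l.1 l.2) w l.1 l.2.

(* Each undirected edge is counted once, as the pair (i, j) with i < j. *)
Definition lrcc_objective (R : realType) (d1 d2 n : nat)
    (e : rel 'I_n) (w : 'I_n -> 'I_n -> R) (gamma1 gamma2 : R)
    (A X : 'I_n -> 'M[R]_(d1, d2)) : R :=
  2^-1 * (\sum_(i < n) frobenius_norm (X i - A i) ^+ 2)
  + gamma1 * (\sum_(i < n) \sum_(j < n | (i < j)%N && e i j)
                w i j * frobenius_norm (X i - X j))
  + gamma2 * (\sum_(i < n) nuclear_norm (X i)).

Definition lrcc_solution (R : realType) (d1 d2 n : nat)
    (e : rel 'I_n) (w : 'I_n -> 'I_n -> R) (gamma1 gamma2 : R)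
    (A X : 'I_n -> 'M[R]_(d1, d2)) : Prop :=
  forall Y : 'I_n -> 'M[R]_(d1, d2),
    lrcc_objective e w gamma1 gamma2 A X <= lrcc_objective e w gamma1 gamma2 A Y.

(* The defining property of mutual independence is written in one stroke:
   taking L i = setT or B i a b = setT recovers all subfamilies. *)
Record low_rank_mixture (R : realType) (d1 d2 n K : nat)
    (disp : measure_display) (Omega : measurableType disp)
    (P : probability Omega R)
    (M : 'I_K -> 'M[R]_(d1, d2)) (p : 'I_K -> R) (sigma : R)
    (s : 'I_n -> Omega -> 'I_K)
    (E : 'I_n -> 'I_d1 -> 'I_d2 -> {RV P >-> R})
    (A : 'I_n -> Omega -> 'M[R]_(d1, d2)) : Prop := LowRankMixture {
  lrm_weight_ge0 : forall k, 0 <= p k;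
  lrm_weight_sum : \sum_(k < K) p k = 1;
  lrm_obs : forall i om,
    A i om = M (s i om) + \matrix_(a < d1, b < d2) E i a b om;
  lrm_label_meas : forall i k, measurable [set om | s i om = k];
  lrm_label_law : forall i k, P [set om | s i om = k] = (p k)%:E;
  lrm_noise_law : forall i a b (B : set R), measurable B ->
    distribution P (E i a b) B = normal_prob 0 sigma B;
  lrm_independent : forall (L : 'I_n -> set 'I_K)
      (B : 'I_n -> 'I_d1 -> 'I_d2 -> set R),
    (forall i a b, measurable (B i a b)) ->
    fine (P [set om | forall i, L i (s i om) /\ forall a b, B i a b (E i a b om)])
    = (\prod_(i < n) fine (P (s i @^-1` L i)))
      * \prod_(i < n) \prod_(a < d1) \prod_(b < d2)
          fine (P (E i a b @^-1` B i a b)) }.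

Section chi_distribution.
Variable R : realType.
Local Notation mR := (measurableTypeR R).

Definition cons_pair d (x : mR * d.-tuple mR) : d.+1.-tuple mR :=
  [the d.+1.-tuple mR of x.1 :: x.2].

Lemma measurable_cons_pair d : measurable_fun setT (@cons_pair d).
Proof. exact: (measurable_cons measurable_fst measurable_snd). Qed.

HB.instance Definition _ d :=
  isMeasurableFun.Build _ _ _ _ (@cons_pair d) (@measurable_cons_pair d).

(* The joint law of d independent standard normal variables. *)
Fixpoint std_gaussian (d : nat) : probability (d.-tuple mR) R :=
  match d with
  | 0 => dirac [tuple]
  | d'.+1 => @distribution _ _ _ _ _
      (@normal_prob R 0 1 \x std_gaussian d')%E (@cons_pair d')
  end.

Definition tuple_norm d (x : d.-tuple mR) : R :=
  Num.sqrt (\sum_(i < d) (tnth x i : R) ^+ 2).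

Lemma measurable_tuple_norm d : measurable_fun setT (@tuple_norm d).
Proof.
apply: (@measurableT_comp _ _ _ _ _ _ (@Num.sqrt R)).
  by apply: continuous_measurable_fun; exact: sqrt_continuous.
apply: measurable_sum => i; apply: measurable_funX; exact: measurable_tnth.
Qed.

HB.instance Definition _ d :=
  isMeasurableFun.Build _ _ _ _ (@tuple_norm d) (@measurable_tuple_norm d).

(* The chi distribution with d degrees of freedom is the law of the Euclidean
   norm of d independent standard normal variables. *)
Definition chi_cdf (d : nat) (t : R) : R :=
  fine (@cdf _ _ _ (std_gaussian d) (@tuple_norm d) t).

End chi_distribution.

Definition near_mean (R : realType) (d1 d2 n : nat) (t sigma : R)
    (Malpha : 'M[R]_(d1, d2)) (A : 'I_n -> 'M[R]_(d1, d2)) : {set 'I_n} :=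
  finset (fun i => frobenius_norm (A i - Malpha) <= t * sigma).

Definition eta (R : realType) (n : nat) (w : 'I_n -> 'I_n -> R)
    (I : {set 'I_n}) (i j : 'I_n) : R :=
  (w i j)^-1 * \sum_(m < n | m \notin I) `|w i m - w j m|.

Definition with_prob_ge (R : realType)
    (disp : measure_display) (Omega : measurableType disp)
    (P : probability Omega R) (q : R) (B : set Omega) : Prop :=
  measurable B /\ (q%:E <= P B)%E.

(* Main.v *)
Require Import Defs.
From mathcomp Require Import all_boot all_order all_algebra.
From mathcomp Require Import spectral complex.
From mathcomp Require Import all_classical all_reals all_analysis.
From mathcomp Require Import measurable_realfun ring lra.

Set Implicit Arguments.
Unset Strict Implicit.
Unset Printing Implicit Defensive.

Import Order.TTheory GRing.Theory Num.Theory.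
Import numFieldNormedType.Exports.

Local Open Scope classical_set_scope.
Local Open Scope ring_scope.

(** Same cluster: with [k] the number of observations in the ball [I], replace
    the [X i] with [i] in [I] by their mean.  Convexity bounds the nuclear norms,
    and averaging over pairs [i, j] in [I] bounds every other change, so that the
    objective drops by at least [1/2 sum ||X i - mean||^2] plus the sum over
    ordered pairs of [(gamma1 w_ij (k - eta_ij) - 2 t sigma) ||X i - X j|| / (2k)].  The
    coefficients are nonnegative once [k >= N], which Hoeffding's inequality for
    the number of [i] with label [alpha] and [||E i|| <= t sigma] provides.

    Different clusters: moving a single [X i] towards [A i] shows that
    [||X i - A i||] is at most the left-hand side of (c1).  With
    [D = M alpha - M beta], it suffices to find [i] and [j], with labels [alpha]
    and [beta] and noise of norm at most [t sigma], such that [<E i, D> >= 0] and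
    [<E j, D> <= 0], since then [||A i - A j|| >= ||D||].  By symmetry of the
    Gaussian, no such [i] exists with probability at most [(1 - F p_alpha / 2)^n].
    The two searches are not independent, but a union bound is enough: if both
    factors of the target are positive, AM-GM makes the two failure
    probabilities at most half of the corresponding error terms.

    The clustering events are measurable because the solution is a Lipschitz
    function of the data. *)

(** * The Frobenius inner product *)

Definition mxdot (R : realType) (m n : nat) (X Y : 'M[R]_(m, n)) : R :=
  \sum_a \sum_b X a b * Y a b.

Section mxdot.
Context {R : realType} {m n : nat}.
Implicit Types X Y Z : 'M[R]_(m, n).

Lemma mxdotC X Y : mxdot X Y = mxdot Y X.
Proof. by apply: eq_bigr => a _; apply: eq_bigr => b _; rewrite mulrC. Qed.

Lemma mxdotDl X Y Z : mxdot (X + Y) Z = mxdot X Z + mxdot Y Z.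
Proof.
rewrite /mxdot -big_split; apply: eq_bigr => a _; rewrite -big_split.
by apply: eq_bigr => b _; rewrite mxE mulrDl.
Qed.

Lemma mxdotZl c X Y : mxdot (c *: X) Y = c * mxdot X Y.
Proof.
rewrite /mxdot mulr_sumr; apply: eq_bigr => a _; rewrite mulr_sumr.
by apply: eq_bigr => b _; rewrite mxE mulrA.
Qed.

Lemma mxdotNl X Y : mxdot (- X) Y = - mxdot X Y.
Proof. by rewrite -scaleN1r mxdotZl mulN1r. Qed.

Lemma mxdotDr X Y Z : mxdot Z (X + Y) = mxdot Z X + mxdot Z Y.
Proof. by rewrite mxdotC mxdotDl !(mxdotC Z). Qed.

Lemma mxdotZr c X Y : mxdot X (c *: Y) = c * mxdot X Y.
Proof. by rewrite mxdotC mxdotZl mxdotC. Qed.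

Lemma mxdotNr X Y : mxdot X (- Y) = - mxdot X Y.
Proof. by rewrite mxdotC mxdotNl mxdotC. Qed.

Lemma mxdotBl X Y Z : mxdot (X - Y) Z = mxdot X Z - mxdot Y Z.
Proof. by rewrite mxdotDl mxdotNl. Qed.

Lemma mxdotBr X Y Z : mxdot Z (X - Y) = mxdot Z X - mxdot Z Y.
Proof. by rewrite mxdotDr mxdotNr. Qed.

Lemma mxdot0l X : mxdot 0 X = 0.
Proof. by rewrite -(scale0r X) mxdotZl mul0r. Qed.

Lemma mxdot_suml (I : Type) (r : seq I) (P : pred I) (F : I -> 'M[R]_(m, n)) X :
  mxdot (\sum_(i <- r | P i) F i) X = \sum_(i <- r | P i) mxdot (F i) X.
Proof.
apply: (big_morph (fun Z => mxdot Z X)) => [Y Z|]; first exact: mxdotDl.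
exact: mxdot0l.
Qed.

Lemma mxdot_ge0 X : 0 <= mxdot X X.
Proof. by apply: sumr_ge0 => a _; apply: sumr_ge0 => b _; rewrite -expr2 sqr_ge0. Qed.

Lemma frobenius_sq X : frobenius_norm X ^+ 2 = mxdot X X.
Proof.
rewrite /frobenius_norm sqr_sqrtr.
  by apply: eq_bigr => a _; apply: eq_bigr => b _; rewrite expr2.
by apply: sumr_ge0 => a _; apply: sumr_ge0 => b _; rewrite sqr_ge0.
Qed.

Lemma frobenius_ge0 X : 0 <= frobenius_norm X.
Proof. exact: sqrtr_ge0. Qed.

Lemma frobenius0_eq0 X : frobenius_norm X = 0 -> X = 0.
Proof.
move=> /(congr1 (fun x => x ^+ 2)); rewrite frobenius_sq expr0n /= => /eqP.
rewrite psumr_eq0 => [/allP X0|a _]; last first.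
  by apply: sumr_ge0 => b _; rewrite -expr2 sqr_ge0.
apply/matrixP => a b; rewrite mxE.
have /eqP := X0 a (mem_index_enum _); move/eqP.
rewrite psumr_eq0 => [/allP Xa0|c _]; last by rewrite -expr2 sqr_ge0.
by have /eqP := Xa0 b (mem_index_enum _); move/eqP; rewrite mulf_eq0 orbb => /eqP.
Qed.

Lemma frobenius0 : frobenius_norm (0 : 'M[R]_(m, n)) = 0.
Proof. by apply/eqP; rewrite -sqrf_eq0 frobenius_sq mxdot0l. Qed.

(** Cauchy-Schwarz: with [x], [y] the norms of nonzero [X], [Y], the squared norm of
    [y *: X - x *: Y] is [2 * (x * y) * (x * y - mxdot X Y)]. *)
Lemma mxdot_le X Y : mxdot X Y <= frobenius_norm X * frobenius_norm Y.
Proof.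
have [->|Xneq0] := eqVneq X 0.
  by rewrite mxdot0l frobenius0 mul0r.
have [->|Yneq0] := eqVneq Y 0.
  by rewrite mxdotC mxdot0l frobenius0 mulr0.
have FX : 0 < frobenius_norm X.
  rewrite lt_neqAle frobenius_ge0 andbT eq_sym.
  by apply: contra Xneq0 => /eqP/frobenius0_eq0 ->.
have FY : 0 < frobenius_norm Y.
  rewrite lt_neqAle frobenius_ge0 andbT eq_sym.
  by apply: contra Yneq0 => /eqP/frobenius0_eq0 ->.
have := mxdot_ge0 (frobenius_norm Y *: X - frobenius_norm X *: Y).
rewrite !(mxdotBl, mxdotBr, mxdotZl, mxdotZr) -!frobenius_sq (mxdotC Y X).
set x := frobenius_norm X in FX *; set y := frobenius_norm Y in FY *.
move: (mxdot X Y) => d h; have {h} : 0 <= 2 * (x * y) * (x * y - d) by lra.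
by rewrite pmulr_rge0 ?subr_ge0// !mulr_gt0.
Qed.

Lemma frobeniusD X Y : frobenius_norm (X + Y) <= frobenius_norm X + frobenius_norm Y.
Proof.
rewrite -(@ler_pXn2r _ 2) ?nnegrE ?addr_ge0 ?frobenius_ge0//.
rewrite frobenius_sq !(mxdotDl, mxdotDr) -!frobenius_sq (mxdotC Y X).
have := mxdot_le X Y; set x := frobenius_norm X; set y := frobenius_norm Y.
by move=> xy; rewrite sqrrD; lra.
Qed.

Lemma frobeniusZ c X : frobenius_norm (c *: X) = `|c| * frobenius_norm X.
Proof.
apply/eqP; rewrite -(@eqrXn2 _ 2) ?mulr_ge0 ?frobenius_ge0//.
by rewrite frobenius_sq mxdotZl mxdotZr exprMn real_normK ?num_real// frobenius_sq mulrA.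
Qed.

Lemma frobeniusN X : frobenius_norm (- X) = frobenius_norm X.
Proof. by rewrite -scaleN1r frobeniusZ normrN1 mul1r. Qed.

Lemma frobeniusBC X Y : frobenius_norm (X - Y) = frobenius_norm (Y - X).
Proof. by rewrite -frobeniusN opprB. Qed.

Lemma frobenius_sum (I : Type) (r : seq I) (P : pred I) (F : I -> 'M[R]_(m, n)) :
  frobenius_norm (\sum_(i <- r | P i) F i) <= \sum_(i <- r | P i) frobenius_norm (F i).
Proof.
elim/big_ind2 : _ => [||//]; first by rewrite frobenius0.
by move=> X1 x1 X2 x2 le1 le2; rewrite (le_trans (frobeniusD _ _))// lerD.
Qed.

Lemma frobenius_le_sum X : frobenius_norm X <= \sum_a \sum_b `|X a b|.
Proof.
have s0 : 0 <= \sum_a \sum_b `|X a b| by apply: sumr_ge0 => a _; apply: sumr_ge0.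
rewrite -(@ler_pXn2r _ 2) ?nnegrE ?frobenius_ge0// frobenius_sq expr2 mulr_suml.
apply: ler_sum => a _; rewrite mulr_suml; apply: ler_sum => b _.
rewrite (le_trans (ler_norm _))// normrM ler_wpM2l//.
rewrite (bigD1 a)//= (bigD1 b)//= -addrA lerDl addr_ge0//.
  exact: sumr_ge0.
by apply: sumr_ge0 => *; apply: sumr_ge0.
Qed.

End mxdot.

(** * The nuclear norm as a support function *)

Section nuclear_norm.
Context {R : realType}.
Local Notation C := R[i].
Local Open Scope sesquilinear_scope.

(** A singular value decomposition without its left factor: [P] diagonalises [X^T *m X], so the
    columns of [B] are orthogonal, with the singular values [r j] as lengths. *)
Lemma nuclear_svd (m n : nat) (X : 'M[R]_(m, n)) :
  exists2 P : 'M[C]_n, P \is unitarymx &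
  exists2 r : 'I_n -> R, nuclear_norm X = \sum_j r j /\ (forall j, 0 <= r j) &
  let B := map_mx (real_complex R) X *m P^t* in
  B^t* *m B = diag_mx (\row_j (r j ^+ 2)%:C%C).
Proof.
set H := map_mx (real_complex R) (X^T *m X).
have HE : H = (map_mx (real_complex R) X)^t* *m map_mx (real_complex R) X.
  rewrite /H map_mxM -map_trmx; congr (_ *m _); apply/matrixP => i j.
  by rewrite !mxE; exact/esym/conjc_real.
have Hn : H \is normalmx.
  by apply/normalmxP; rewrite HE trmx_mul map_mxM trmxCK.
have /orthomx_spectralP := Hn.
set P := spectralmx H; set d := spectral_diag H => Hd.
have Pu : P \is unitarymx := spectral_unitarymx H.
rewrite invmx_unitary// in Hd.
set B := map_mx (real_complex R) X *m P^t*.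
have BB : B^t* *m B = diag_mx d.
  rewrite /B trmx_mul map_mxM trmxCK mulmxA -(mulmxA P) -HE Hd.
  by rewrite !mulmxA (unitarymxP _)// mul1mx -mulmxA (unitarymxP _)// mulmx1.
(* Each eigenvalue is the squared length of a column of [B]; being nonnegative in [R[i]], it is
   real. *)
have d_ge0 j : 0 <= d 0 j.
  have /matrixP/(_ j j) := BB; rewrite !mxE eqxx mulr1n => <-.
  by apply: sumr_ge0 => a _; rewrite !mxE mulrC mul_conjC_ge0.
have dE j : d 0 j = (Num.sqrt (complex.Re (d 0 j)) ^+ 2)%:C%C.
  have := d_ge0 j; case: (d 0 j) => x y; rewrite lecE /= => /andP[/eqP -> x0].
  by rewrite sqr_sqrtr.
exists P => //; exists (fun j => Num.sqrt (complex.Re (d 0 j))).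
  by split => // j; exact: sqrtr_ge0.
rewrite /= -/B BB; congr diag_mx; apply/rowP => j; rewrite mxE; exact: dE.
Qed.

Lemma Re_sum (I : Type) (r : seq I) (P : pred I) (F : I -> C) :
  complex.Re (\sum_(i <- r | P i) F i) = \sum_(i <- r | P i) complex.Re (F i).
Proof. by apply: (big_morph (@complex.Re R)) => // [[? ?] [? ?]]. Qed.

Lemma Re_dot_le (m : nat) (u v : 'rV[C]_m) (a b : R) : 0 <= a -> 0 <= b ->
  dotmx u u <= (a ^+ 2)%:C%C -> dotmx v v <= (b ^+ 2)%:C%C ->
  complex.Re (dotmx u v) <= a * b.
Proof.
move=> a0 b0 ua vb.
have H : `|dotmx u v| ^+ 2 <= ((a * b) ^+ 2)%:C%C.
  have [H _] := CauchySchwarz (@dotmx C m) u v; apply: (le_trans H).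
  rewrite exprMn rmorphM ler_pM// dnorm_ge0//.
case: (dotmx u v) H => x y; rewrite -add_Re2_Im2 lecR/= => H.
apply: (le_trans (ler_norm _)).
rewrite -(@ler_pXn2r _ 2) ?nnegrE ?mulr_ge0// real_normK ?num_real//.
by apply: le_trans H; rewrite lerDl sqr_ge0.
Qed.

(** Against a real matrix only the real part of [W] counts, so a certificate found over [R[i]]
    yields a real one. *)
Lemma mxdot_Re (m n : nat) (W : 'M[C]_(m, n)) (Z : 'M[R]_(m, n)) :
  mxdot (map_mx (@complex.Re R) W) Z =
  complex.Re (\tr (W^t* *m map_mx (real_complex R) Z)).
Proof.
rewrite /mxtrace Re_sum /mxdot exchange_big; apply: eq_bigr => b _.
rewrite mxE Re_sum; apply: eq_bigr => a _; rewrite !mxE.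
by case: (W a b) => x y /=; rewrite mulr0 subr0.
Qed.

(** [W] is a subgradient at [X], and the convexity of the nuclear norm follows from its existence.
    It is the polar factor of [X]: normalise the nonzero columns of [B], rotate back by [P], and
    take real parts. *)
Lemma nuclear_dual (m n : nat) (X : 'M[R]_(m, n)) :
  exists2 W : 'M[R]_(m, n), mxdot W X = nuclear_norm X &
    forall Z, mxdot W Z <= nuclear_norm Z.
Proof.
have [P Pu [r [-> r0] /=]] := nuclear_svd X.
set B := map_mx _ X *m _ => BB.
(* Since [0^-1 = 0], a zero singular value gives a zero column of [Y]. *)
pose S : 'M[C]_n := diag_mx (\row_j ((r j)^-1)%:C%C).
pose Y := B *m S.
have Sh : S^t* = S.
  rewrite /S tr_diag_mx map_diag_mx; congr diag_mx; apply/rowP => j.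
  by rewrite !mxE; exact: conjc_real.
have YB : Y^t* *m B = diag_mx (\row_j (r j)%:C%C).
  rewrite /Y trmx_mul map_mxM Sh -mulmxA BB mulmx_diag; congr diag_mx.
  apply/rowP => j; rewrite !mxE -rmorphM; congr (_%:C%C).
  have [->|rj] := eqVneq (r j) 0; first by rewrite invr0 mul0r.
  by rewrite expr2 mulKf.
have YY : Y^t* *m Y = diag_mx (\row_j (r j != 0)%:R).
  rewrite {2}/Y mulmxA YB mulmx_diag; congr diag_mx.
  apply/rowP => j; rewrite !mxE -rmorphM.
  have [->|rj] := eqVneq (r j) 0; first by rewrite invr0 mul0r.
  by rewrite mulfV.
exists (map_mx (@complex.Re R) (Y *m P)).
  rewrite mxdot_Re trmx_mul map_mxM -mulmxA mxtrace_mulC -mulmxA -/B YB.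
  rewrite mxtrace_diag Re_sum; apply: eq_bigr => j _.
  by rewrite mxE.
move=> Z; rewrite mxdot_Re.
have [Q Qu [q [-> q0] /=]] := nuclear_svd Z.
set D := map_mx _ Z *m _ => DD.
have -> : map_mx (real_complex R) Z = D *m Q by rewrite mulmxKtV.
rewrite mulmxA mxtrace_mulC mulmxA.
(* In the right singular basis [Q] of [Z], the trace is the sum over [j] of the inner products of
   the columns [j] of [T] and [D]; the latter has length [q j], the former length at most 1. *)
set T := Y *m P *m Q^t*.
have -> : Q *m (Y *m P)^t* = T^t* by rewrite /T [in RHS]trmx_mul [in RHS]map_mxM trmxCK.
rewrite /mxtrace Re_sum; apply: ler_sum => j _.
have dotE (U V : 'M[C]_(m, n)) : dotmx (row j U^T) (row j V^T) = (V^t* *m U) j j.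
  by rewrite dotmxE !mxE; apply: eq_bigr => a _; rewrite !mxE mulrC.
rewrite -dotE -[leRHS]mulr1; apply: Re_dot_le => //.
  by rewrite dotE DD !mxE eqxx mulr1n.
rewrite dotE /T -mulmxA; set V := P *m Q^t*.
have Vu : V^t* \is unitarymx.
  rewrite trmxC_unitary; apply: mul_unitarymx; first exact: Pu.
  by rewrite trmxC_unitary; exact: Qu.
(* The 0-1 diagonal matrix [Y^t* *m Y] only drops terms from the squared length of column [j] of the
   unitary matrix [V], which is 1. *)
rewrite trmx_mul map_mxM mulmxA -(mulmxA (V^t*)) YY.
have /unitarymxP := Vu; rewrite trmxCK => /matrixP/(_ j j).
have -> : (1%:M : 'M[C]_n) j j = 1 by rewrite mxE eqxx.
rewrite [in X in X -> _]mxE => V1; rewrite expr1n.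
rewrite -[leRHS]/(1 : C) -[leRHS]V1 {V1}.
rewrite mxE; apply: ler_sum => k _; rewrite mul_mx_diag.
have : 0 <= V^t* j k * V k j by rewrite !mxE mulrC mul_conjC_ge0.
rewrite [X in _ -> X * _ <= _]mxE [X in _ -> _ * X * _ <= _]mxE.
by case: (r k != 0); rewrite ?mulr1// mulr0 mul0r.
Qed.

Lemma nuclear_ge0 (m n : nat) (X : 'M[R]_(m, n)) : 0 <= nuclear_norm X.
Proof. by apply: sumr_ge0 => j _; exact: sqrtr_ge0. Qed.

(** The certificate of [X + Y] is tested on each summand. *)
Lemma nuclearD (m n : nat) (X Y : 'M[R]_(m, n)) :
  nuclear_norm (X + Y) <= nuclear_norm X + nuclear_norm Y.
Proof.
by have [W <- Wle] := nuclear_dual (X + Y); rewrite mxdotDr lerD.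
Qed.

Lemma nuclearZ (m n : nat) (c : R) (X : 'M[R]_(m, n)) : 0 <= c ->
  nuclear_norm (c *: X) <= c * nuclear_norm X.
Proof.
by have [W <- Wle] := nuclear_dual (c *: X) => c0; rewrite mxdotZr ler_wpM2l.
Qed.

Lemma nuclear0 (m n : nat) : nuclear_norm (0 : 'M[R]_(m, n)) = 0.
Proof.
apply/eqP; rewrite eq_le nuclear_ge0 andbT -(scale0r 0).
by rewrite (le_trans (nuclearZ _ _))// mul0r.
Qed.

Lemma nuclear_sum (m n : nat) (I : Type) (r : seq I) (P : pred I)
    (F : I -> 'M[R]_(m, n)) :
  nuclear_norm (\sum_(i <- r | P i) F i) <= \sum_(i <- r | P i) nuclear_norm (F i).
Proof.
elim/big_ind2 : _ => [||//]; first by rewrite nuclear0.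
by move=> X1 x1 X2 x2 le1 le2; rewrite (le_trans (nuclearD _ _))// lerD.
Qed.

(** Cauchy-Schwarz between the vector of singular values and the all-ones vector; the squared
    singular values sum to the trace of [X^T *m X]. *)
Lemma nuclear_le_frobenius (m n : nat) (X : 'M[R]_(m, n)) :
  nuclear_norm X <= Num.sqrt n%:R * frobenius_norm X.
Proof.
have [P Pu [r [-> r0] /=]] := nuclear_svd X.
set B := map_mx _ X *m _ => BB.
have r2 : \sum_j r j ^+ 2 = frobenius_norm X ^+ 2.
  apply: complexI; rewrite rmorph_sum.
  transitivity (\tr (B^t* *m B)).
    by rewrite BB mxtrace_diag; apply: eq_bigr => j _; rewrite mxE.
  rewrite {2}/B mulmxA mxtrace_mulC /B trmx_mul map_mxM trmxCK !mulmxA mxtrace_mulC.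
  rewrite !mulmxA mulmxKtV// frobenius_sq rmorph_sum.
  apply: eq_bigr => a _; rewrite mxE rmorph_sum; apply: eq_bigr => b _.
  rewrite !mxE rmorphM; congr (_ * _); exact: conjc_real.
pose u : 'M[R]_(1, n) := \row_j r j; pose v : 'M[R]_(1, n) := const_mx 1.
have uX : frobenius_norm u = frobenius_norm X.
  apply/eqP; rewrite -(@eqrXn2 _ 2) ?frobenius_ge0// -r2 frobenius_sq.
  by rewrite /mxdot big_ord1; apply/eqP/eq_bigr => j _; rewrite mxE expr2.
have vn : frobenius_norm v = Num.sqrt n%:R.
  congr Num.sqrt; rewrite big_ord1 (eq_bigr (fun=> 1)) ?sumr_const ?card_ord//.
  by move=> j _; rewrite mxE expr1n.
rewrite mulrC -uX -vn (le_trans _ (mxdot_le u v))// /mxdot big_ord1.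
by apply: ler_sum => j _; rewrite !mxE mulr1.
Qed.

End nuclear_norm.

(** * Deterministic analysis of the lrCC problem *)

Section objective.
Context {R : realType} {d1 d2 n : nat}.
Variables (e : rel 'I_n) (w : 'I_n -> 'I_n -> R) (gamma1 gamma2 : R).
Hypothesis graph : weighted_graph e w.
Implicit Types (A X Y : 'I_n -> 'M[R]_(d1, d2)) (I : {set 'I_n}).

Lemma weight_ge0 i j : 0 <= w i j.
Proof.
have [eij|/(wg_zero graph) -> //] := boolP (e i j).
exact/ltW/(wg_pos graph).
Qed.

Lemma weight_diag i : w i i = 0.
Proof. by rewrite (wg_zero graph)// (wg_irr graph). Qed.

(** Non-edges and the diagonal carry weight zero, so the sum over edges is half of an unrestricted
    symmetric sum, which is easier to split and exchange. *)
Lemma sum_edgesE (f : 'I_n -> 'I_n -> R) : (forall i j, f i j = f j i) ->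
  \sum_(i < n) \sum_(j < n | (i < j)%N && e i j) w i j * f i j =
  2^-1 * \sum_i \sum_j w i j * f i j.
Proof.
move=> fC; pose g i j := w i j * f i j.
have gC i j : g i j = g j i by rewrite /g fC (wg_wsym graph).
transitivity (\sum_(i < n) \sum_(j < n | (i < j)%N) g i j).
  apply: eq_bigr => i _; rewrite big_mkcondr/=; apply: eq_bigr => j _.
  by case: ifPn => // /(wg_zero graph) wij; rewrite /g wij mul0r.
have -> : \sum_i \sum_j g i j =
    \sum_(i < n) \sum_(j < n | (i < j)%N) g i j +
    \sum_(i < n) \sum_(j < n | (j < i)%N) g i j.
  rewrite -big_split/=; apply: eq_bigr => i _.
  rewrite (bigID (fun j : 'I_n => (i < j)%N))/=; congr (_ + _).
  rewrite [LHS](bigD1 i) ?ltnn//= {1}/g weight_diag mul0r add0r.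
  by apply: eq_bigl => j; rewrite -leqNgt ltn_neqAle andbC.
have -> : \sum_(i < n) \sum_(j < n | (j < i)%N) g i j =
    \sum_(i < n) \sum_(j < n | (i < j)%N) g i j.
  rewrite (exchange_big_dep predT)//=; apply: eq_bigr => i _.
  by apply: eq_bigr => j _; exact: gC.
lra.
Qed.

Lemma lrcc_objectiveE A X : lrcc_objective e w gamma1 gamma2 A X =
  2^-1 * (\sum_i frobenius_norm (X i - A i) ^+ 2)
  + gamma1 * (2^-1 * \sum_i \sum_j w i j * frobenius_norm (X i - X j))
  + gamma2 * (\sum_i nuclear_norm (X i)).
Proof.
rewrite /lrcc_objective sum_edgesE// => i j; exact: frobeniusBC.
Qed.

Hypotheses (gamma1_ge0 : 0 <= gamma1) (gamma2_ge0 : 0 <= gamma2).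

(** Test both solutions against their midpoint [Y]. By convexity the fusion and nuclear terms drop
    out of the sum of the two optimality inequalities, which leaves a comparison of data terms. *)
Lemma lrcc_solution_lipschitz A X A' X' :
  lrcc_solution e w gamma1 gamma2 A X -> lrcc_solution e w gamma1 gamma2 A' X' ->
  \sum_i frobenius_norm (X i - X' i) ^+ 2 <=
  4 * \sum_i frobenius_norm (A i - A' i) ^+ 2.
Proof.
move=> sX sX'; pose Y i := 2^-1 *: (X i + X' i).
have := sX Y; have := sX' Y; rewrite !lrcc_objectiveE.
have fus : 2 * \sum_i \sum_j w i j * frobenius_norm (Y i - Y j) <=
    \sum_i \sum_j w i j * frobenius_norm (X i - X j) +
    \sum_i \sum_j w i j * frobenius_norm (X' i - X' j).
  rewrite -big_split/= mulr_sumr; apply: ler_sum => i _.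
  rewrite -big_split/= mulr_sumr; apply: ler_sum => j _.
  rewrite -mulrDr mulrCA ler_wpM2l ?weight_ge0//.
  rewrite /Y -scalerBr frobeniusZ ger0_norm// mulrA divff// mul1r.
  by rewrite opprD addrACA frobeniusD.
have nuc : 2 * \sum_i nuclear_norm (Y i) <=
    \sum_i nuclear_norm (X i) + \sum_i nuclear_norm (X' i).
  rewrite -big_split/= mulr_sumr; apply: ler_sum => i _.
  rewrite mulrC -ler_pdivlMr// mulrC (le_trans (nuclearZ _ _))//.
  by rewrite ler_wpM2l// nuclearD.
move: fus => /(ler_wpM2l gamma1_ge0) fus.
move: nuc => /(ler_wpM2l gamma2_ge0) nuc H1 H2.
have {H1 H2 fus nuc} :
    \sum_i frobenius_norm (X i - A i) ^+ 2 + \sum_i frobenius_norm (X' i - A' i) ^+ 2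
    <= \sum_i frobenius_norm (Y i - A i) ^+ 2 + \sum_i frobenius_norm (Y i - A' i) ^+ 2.
  move: fus nuc H1 H2; rewrite ![gamma1 * (2^-1 * _)]mulrA ![gamma1 / 2]mulrC.
  rewrite -![2^-1 * gamma1 * _]mulrA.
  rewrite ![gamma1 * (_ + _)]mulrDr ![gamma2 * (_ + _)]mulrDr.
  rewrite ![gamma1 * (2 * _)]mulrCA ![gamma2 * (2 * _)]mulrCA.
  lra.
rewrite -subr_le0 -(@pmulr_rle0 _ 4)// -[_ <= 4 * _]subr_le0; apply: le_trans.
rewrite -!big_split/= -sumrB mulr_sumr mulr_sumr -sumrB; apply: ler_sum => i _.
pose D := X' i - X i; pose U := X i - A i; pose V := A' i - A i.
have -> : X' i - A' i = U + D - V.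
  by rewrite /U /D /V; apply/matrixP => a b; rewrite !mxE; ring.
have -> : Y i - A i = U + 2^-1 *: D.
  by rewrite /Y /U /D; apply/matrixP => a b; rewrite !mxE; field.
have -> : Y i - A' i = U + 2^-1 *: D - V.
  by rewrite /Y /U /D /V; apply/matrixP => a b; rewrite !mxE; field.
have -> : X i - X' i = - D by rewrite /D opprB.
have -> : A i - A' i = - V by rewrite /V opprB.
rewrite -/U !frobeniusN !frobenius_sq.
clearbody D U V.
(* Four times the gap between the data terms exceeds [||D||^2 - 4 * ||V||^2] by exactly this
   square. *)
have := mxdot_ge0 (D - 2 *: V).
rewrite !(mxdotDl, mxdotDr, mxdotZl, mxdotZr, mxdotNl, mxdotNr).
by rewrite (mxdotC V U) (mxdotC D U) (mxdotC V D); lra.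
Qed.

(** When [X] changes only on [I], the fusion terms of outer pairs cancel; inner pairs remain and,
    twice, the pairs across the boundary. Used for the ball and for a single vertex. *)
Lemma sum_pairs_split (g : 'I_n -> 'I_n -> R) I :
  (forall i j, g i j = g j i) ->
  (forall i j, i \notin I -> j \notin I -> g i j = 0) ->
  \sum_i \sum_j g i j = \sum_(i in I) \sum_(j in I) g i j
    + 2 * \sum_(m | m \notin I) \sum_(i in I) g i m.
Proof.
move=> gC g0; rewrite (bigID (mem I))/=.
under eq_bigr do rewrite (bigID (mem I))/=.
rewrite big_split/= -addrA; congr (_ + _).
have -> : \sum_(i | i \notin I) \sum_j g i j = \sum_(i | i \notin I) \sum_(j in I) g j i.
  apply: eq_bigr => i iI; rewrite (bigID (mem I))/= [X in _ + X]big1 ?addr0.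
    by apply: eq_bigr => j _; exact: gC.
  by move=> j jI; rewrite g0.
by rewrite exchange_big/= mulr_natl mulr2n.
Qed.

(* The edges leaving [I] can only pull its members apart through the
   differences of their weights towards a common outer vertex. *)
Lemma fusion_outside_le X I m : (0 < #|I|)%N ->
  - ((2 * #|I|%:R)^-1 * \sum_(i in I) \sum_(j in I)
       `|w i m - w j m| * frobenius_norm (X i - X j)) <=
  \sum_(i in I) w i m * (frobenius_norm (X i - X m)
    - frobenius_norm (#|I|%:R^-1 *: \sum_(j in I) X j - X m)).
Proof.
set Xbar := _ *: _; move=> I_gt0; have k_gt0 : 0 < #|I|%:R :> R by rewrite ltr0n.
set k : R := #|I|%:R in k_gt0 *.
have k_ge0 : 0 <= k^-1 by rewrite invr_ge0 ltW.
pose c i := frobenius_norm (X i - X m).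
have Xbar_le : frobenius_norm (Xbar - X m) <= k^-1 * \sum_(j in I) c j.
  have -> : Xbar - X m = k^-1 *: \sum_(j in I) (X j - X m).
    rewrite big_split/= sumr_const scalerDr -scaler_nat scalerA mulVf ?gt_eqF//.
    by rewrite scale1r.
  by rewrite frobeniusZ ger0_norm// ler_wpM2l// frobenius_sum.
apply: (@le_trans _ _ (\sum_(i in I) w i m * (c i - k^-1 * \sum_(j in I) c j)));
  last first.
  by apply: ler_sum => i iI; rewrite ler_wpM2l ?weight_ge0// lerB.
(* Chebyshev's sum identity: pairing the weights with the centred [c i] involves only differences
   [w i m - w j m]. *)
have -> : \sum_(i in I) w i m * (c i - k^-1 * \sum_(j in I) c j) =
    (2 * k)^-1 * \sum_(i in I) \sum_(j in I) (w i m - w j m) * (c i - c j).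
  have E : \sum_(i in I) \sum_(j in I) (w i m - w j m) * (c i - c j) =
      2 * (k * \sum_(i in I) w i m * c i - (\sum_(i in I) w i m) * \sum_(j in I) c j).
    under eq_bigr => i _ do under eq_bigr => j _ do rewrite mulrBl !mulrBr.
    under eq_bigr => i _ do rewrite !(sumrB, big_split)/= sumr_const -mulr_sumr -mulr_suml.
    rewrite !sumrB/= sumr_const -[X in _ - (X - _)]mulr_sumr -!mulr_suml.
    rewrite -(mulr_natl (\sum_(i in I) w i m * c i)) -/k.
    under eq_bigr do rewrite -mulr_natl -/k.
    by rewrite -mulr_sumr; ring.
  rewrite E; under eq_bigr do rewrite mulrBr.
  rewrite sumrB -mulr_suml; move: (\sum_(i in I) w i m) => W.
  move: (\sum_(i in I) w i m * c i) (\sum_(i in I) c i) => S1 S2.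
  by field; rewrite gt_eqF.
rewrite -mulrN -sumrN ler_wpM2l ?invfM ?mulr_ge0//.
apply: ler_sum => i _; rewrite -sumrN; apply: ler_sum => j _.
have cc : `|c i - c j| <= frobenius_norm (X i - X j).
  rewrite ler_norml; apply/andP; split.
    rewrite lerNl opprB lerBlDr /c.
    have -> : X j - X m = (X j - X i) + (X i - X m) by rewrite addrA subrK.
    by rewrite (frobeniusBC (X i) (X j)) frobeniusD.
  rewrite lerBlDr /c.
  have -> : X i - X m = (X i - X j) + (X j - X m) by rewrite addrA subrK.
  by rewrite frobeniusD.
rewrite lerNl (le_trans (ler_norm _))// normrN normrM.
by rewrite ler_wpM2l.
Qed.

(** Deterministic core of the first part, with [rho] for [t * sigma] and [N] a lower bound on the
    size of the ball. [Y] averages [X] over [I]; gains and losses are written as double sums over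
    [I] and compared pair by pair. *)
Lemma lrcc_solution_fused A X (Mu : 'M[R]_(d1, d2)) (rho N : R) I :
  lrcc_solution e w gamma1 gamma2 A X ->
  (forall i, i \in I -> frobenius_norm (A i - Mu) <= rho) ->
  N <= #|I|%:R ->
  (forall i j, i \in I -> j \in I -> i != j -> e i j /\ eta w I i j < N) ->
  (forall i j, i \in I -> j \in I -> i != j ->
     2 * rho / (w i j * (N - eta w I i j)) <= gamma1) ->
  forall i j, i \in I -> j \in I -> X i = X j.
Proof.
move=> sX near_Mu NI clique gamma1_ge.
suff XE i : i \in I -> X i = (#|I|%:R)^-1 *: \sum_(i in I) X i.
  by move=> i j /XE -> /XE ->.
move=> iI; have I_gt0 : (0 < #|I|)%N by apply/card_gt0P; exists i.
have k_gt0 : 0 < #|I|%:R :> R by rewrite ltr0n.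
have k_ge0 : 0 <= #|I|%:R^-1 :> R by rewrite invr_ge0 ltW.
set Xbar := _ *: _; pose Y i := if i \in I then Xbar else X i.
pose D i j := frobenius_norm (X i - X j).
have YI j : j \in I -> Y j = Xbar by rewrite /Y => ->.
have YN j : j \notin I -> Y j = X j by rewrite /Y => /negbTE ->.
have nuc : \sum_i nuclear_norm (Y i) <= \sum_i nuclear_norm (X i).
  rewrite (bigID (mem I))/= [leRHS](bigID (mem I))/= lerD//; last first.
    by apply: ler_sum => j jI; rewrite YN.
  rewrite (eq_bigr (fun=> nuclear_norm Xbar)); last by move=> j /YI ->.
  rewrite sumr_const -mulr_natl mulrC -ler_pdivlMr// mulrC.
  by rewrite (le_trans (nuclearZ _ _))// ler_wpM2l// nuclear_sum.
have fus : \sum_(i in I) \sum_(j in I) w i j * D i j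
    - #|I|%:R^-1 * \sum_(i in I) \sum_(j in I)
        (\sum_(m | m \notin I) `|w i m - w j m|) * D i j <=
    \sum_i \sum_j w i j * D i j - \sum_i \sum_j w i j * frobenius_norm (Y i - Y j).
  rewrite -sumrB; under [leRHS]eq_bigr do rewrite -sumrB.
  rewrite (@sum_pairs_split _ I); first last.
  - by move=> a b aI bI; rewrite !YN// subrr.
  - by move=> a b; rewrite /D (wg_wsym graph a b) frobeniusBC (frobeniusBC (Y a)).
  apply: lerD.
    apply: ler_sum => a aI; apply: ler_sum => b bI.
    by rewrite !YI// subrr frobenius0 mulr0 subr0.
  have -> : \sum_(i in I) \sum_(j in I)
      (\sum_(m | m \notin I) `|w i m - w j m|) * D i j =
      \sum_(m | m \notin I) \sum_(i in I) \sum_(j in I) `|w i m - w j m| * D i j.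
    rewrite [RHS]exchange_big/=; apply: eq_bigr => a _.
    by rewrite [RHS]exchange_big/=; apply: eq_bigr => b _; rewrite mulr_suml.
  rewrite [_^-1 * _]mulr_sumr [2 * _]mulr_sumr -sumrN; apply: ler_sum => m mI.
  have := ler_wpM2l (ler0n R 2) (fusion_outside_le X m I_gt0).
  rewrite mulrN mulrA invfM mulrA divff ?pnatr_eq0// mul1r => /le_trans; apply.
  by rewrite ler_wpM2l//; apply: ler_sum => a aI; rewrite YI// YN// mulrBr.
have data : \sum_(i in I) frobenius_norm (X i - Xbar) ^+ 2
    - #|I|%:R^-1 * \sum_(i in I) \sum_(j in I) 2 * rho * D i j <=
    \sum_i frobenius_norm (X i - A i) ^+ 2 - \sum_i frobenius_norm (Y i - A i) ^+ 2.
  rewrite -sumrB [leRHS](bigID (mem I))/= [X in _ <= _ + X]big1 ?addr0; last first.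
    by move=> j jI; rewrite YN// subrr.
  have sum0 : \sum_(i in I) (X i - Xbar) = 0.
    rewrite sumrB sumr_const -[Xbar *+ _]scaler_nat scalerA divff ?gt_eqF// scale1r.
    by rewrite subrr.
  have -> : \sum_(i in I) (frobenius_norm (X i - A i) ^+ 2 - frobenius_norm (Y i - A i) ^+ 2)
      = \sum_(i in I) frobenius_norm (X i - Xbar) ^+ 2
        - 2 * \sum_(i in I) mxdot (X i - Xbar) (A i).
    transitivity (\sum_(i in I) frobenius_norm (X i - Xbar) ^+ 2
        - 2 * \sum_(i in I) mxdot (X i - Xbar) (A i)
        + 2 * mxdot (\sum_(i in I) (X i - Xbar)) Xbar).
      rewrite mxdot_suml !mulr_sumr -sumrB -big_split; apply: eq_bigr => a aI /=.
      rewrite YI// !frobenius_sq !(mxdotBl, mxdotBr).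
      by rewrite (mxdotC Xbar (X a)) (mxdotC (A a) (X a)) (mxdotC (A a) Xbar); ring.
    by rewrite sum0 mxdot0l mulr0 addr0.
  rewrite lerD2l lerN2.
  (* Symmetrising over pairs leaves only differences of the data, which have norm at most [2 * rho]
     inside the ball. *)
  have -> : 2 * \sum_(i in I) mxdot (X i - Xbar) (A i) =
      #|I|%:R^-1 * \sum_(i in I) \sum_(j in I) mxdot (X i - X j) (A i - A j).
    have XA a : mxdot (X a - Xbar) (A a) =
        #|I|%:R^-1 * \sum_(j in I) mxdot (X a - X j) (A a).
      rewrite -mxdot_suml -mxdotZl sumrB sumr_const scalerBr -[X a *+ _]scaler_nat.
      by rewrite scalerA mulVf ?gt_eqF// scale1r.
    under eq_bigr do rewrite XA.
    rewrite -mulr_sumr mulrCA; congr (_ * _).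
    under [RHS]eq_bigr do under eq_bigr do rewrite mxdotBr.
    under [RHS]eq_bigr do rewrite sumrB.
    rewrite sumrB mulr_natl mulr2n; congr (_ + _).
    rewrite exchange_big/= -sumrN; apply: eq_bigr => a _.
    rewrite -sumrN; apply: eq_bigr => b _.
    by rewrite -mxdotNl opprB.
  rewrite ler_wpM2l//.
  apply: ler_sum => a aI; apply: ler_sum => b bI.
  rewrite (le_trans (mxdot_le _ _))// mulrC ler_wpM2r ?frobenius_ge0//.
  have -> : A a - A b = (A a - Mu) - (A b - Mu) by rewrite opprB addrA subrK.
  rewrite (le_trans (frobeniusD _ _))// frobeniusN mulr_natl mulr2n lerD//.
    exact: near_Mu.
  exact: near_Mu.
(* Both conditions enter here: edges make [w i j] positive, and the bound on [gamma1], cleared of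
   its denominator, is combined with [N <= #|I|]. *)
have pair : 0 <= \sum_(i in I) \sum_(j in I) (gamma1 * (#|I|%:R * w i j
    - \sum_(m | m \notin I) `|w i m - w j m|) - 2 * rho) * D i j.
  apply: sumr_ge0 => a aI; apply: sumr_ge0 => b bI.
  have [->|ab] := eqVneq a b; first by rewrite /D subrr frobenius0 mulr0.
  apply: mulr_ge0; last exact: frobenius_ge0.
  have [eab eta_lt] := clique a b aI bI ab.
  have wab := wg_pos graph eab.
  have := gamma1_ge a b aI bI ab.
  rewrite ler_pdivrMr ?mulr_gt0 ?subr_gt0// -subr_ge0 => /le_trans; apply.
  rewrite lerD2r ler_wpM2l//.
  have -> : \sum_(m | m \notin I) `|w a m - w b m| = w a b * eta w I a b.
    by rewrite /eta mulrA divff ?mul1r// gt_eqF.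
  by rewrite mulrBr lerD2r mulrC ler_wpM2r// ltW.
have {}pair : 0 <= gamma1 * (\sum_(i in I) \sum_(j in I) w i j * D i j
    - #|I|%:R^-1 * \sum_(i in I) \sum_(j in I)
        (\sum_(m | m \notin I) `|w i m - w j m|) * D i j)
    - #|I|%:R^-1 * \sum_(i in I) \sum_(j in I) 2 * rho * D i j.
  have := mulr_ge0 k_ge0 pair.
  congr (0 <= _); rewrite mulrBr.
  rewrite !mulr_sumr -!sumrB; apply: eq_bigr => a _.
  rewrite !mulr_sumr -!sumrB; apply: eq_bigr => b _.
  by field; rewrite gt_eqF.
have := sX Y; rewrite !lrcc_objectiveE => opt.
move: fus nuc => /(ler_wpM2l gamma1_ge0) fus /(ler_wpM2l gamma2_ge0) nuc.
have le0 : \sum_(i in I) frobenius_norm (X i - Xbar) ^+ 2 <= 0.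
  move: opt data fus nuc pair; rewrite -/D !mulrBr ![gamma1 * (2^-1 * _)]mulrCA.
  by lra.
have /eqP : \sum_(i in I) frobenius_norm (X i - Xbar) ^+ 2 = 0.
  by apply/eqP; rewrite eq_le le0 sumr_ge0// => ? _; exact: sqr_ge0.
rewrite psumr_eq0 => [/allP/(_ i (mem_index_enum _))|? _]; last exact: sqr_ge0.
by rewrite iI/= sqrf_eq0 => /eqP/frobenius0_eq0/eqP; rewrite subr_eq0 => /eqP.
Qed.

(** One-sided first-order optimality of [X i] in the direction of [A i]: per unit of distance, the
    fusion terms grow by at most the sum of the weights at [i], and the nuclear norm by at most
    [Num.sqrt d2%:R]. *)
Lemma lrcc_solution_close A X i :
  lrcc_solution e w gamma1 gamma2 A X ->
  frobenius_norm (X i - A i) <=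
    gamma1 * (n%:R - 1) * max_weight e w + gamma2 * Num.sqrt d2%:R.
Proof.
move=> sX; set r := frobenius_norm _; set G := _ + _.
have sum_w : \sum_j w i j <= (n%:R - 1) * max_weight e w.
  rewrite (bigD1 i)//= weight_diag add0r.
  apply: (@le_trans _ _ (\sum_(j | j != i) max_weight e w)).
    (* A non-edge has weight 0, and the maximum starts from 0. *)
    apply: ler_sum => j ji; have [eij|/(wg_zero graph) ->] := boolP (e i j).
      exact: (le_bigmax_cond _ (fun l => w l.1 l.2) (j := (i, j))).
    by rewrite /max_weight; apply: bigmax_ge_id.
  rewrite sumr_const -[leLHS]mulr_natl cardC1 card_ord -subn1 natrB//.
  exact: (leq_ltn_trans _ (ltn_ord i)).
(* After a move by the fraction [th], the data term falls by [th * (1 - th / 2) * r ^+ 2], and the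
   penalties grow by at most [th * G * r]. *)
have key (th : R) : 0 < th -> th < 1 -> (1 - th / 2) * r ^+ 2 <= G * r.
  move=> th0 th1; pose Y j := if j == i then X i + th *: (A i - X i) else X j.
  have Yi : Y i = X i + th *: (A i - X i) by rewrite /Y eqxx.
  have YN j : j != i -> Y j = X j by rewrite /Y => /negbTE ->.
  have dist : frobenius_norm (Y i - X i) = th * r.
    by rewrite Yi addrC addKr frobeniusZ gtr0_norm// frobeniusBC.
  have data : \sum_j frobenius_norm (X j - A j) ^+ 2 - \sum_j frobenius_norm (Y j - A j) ^+ 2
      = th * (2 - th) * r ^+ 2.
    rewrite -sumrB (bigD1 i)//= big1 ?addr0; last by move=> j ji; rewrite YN// subrr.
    have -> : Y i - A i = (1 - th) *: (X i - A i).
      by rewrite Yi; apply/matrixP => a b; rewrite !mxE; ring.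
    rewrite frobeniusZ exprMn real_normK ?num_real// -/r; ring.
  have nuc : \sum_j nuclear_norm (Y j) - \sum_j nuclear_norm (X j) <=
      Num.sqrt d2%:R * (th * r).
    rewrite -sumrB (bigD1 i)//= big1 ?addr0; last by move=> j ji; rewrite YN// subrr.
    rewrite lerBlDl -{1}(subrK (X i) (Y i)) addrC (le_trans (nuclearD _ _))// lerD2l.
    by rewrite -dist nuclear_le_frobenius.
  have fus : \sum_j \sum_k w j k * frobenius_norm (Y j - Y k)
      - \sum_j \sum_k w j k * frobenius_norm (X j - X k) <=
      2 * ((n%:R - 1) * max_weight e w * (th * r)).
    rewrite -sumrB; under eq_bigr do rewrite -sumrB.
    rewrite (@sum_pairs_split _ [set i]); first last.
    - by move=> a b; rewrite !inE => ai bi; rewrite !YN// subrr.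
    - by move=> a b; rewrite (wg_wsym graph a b) (frobeniusBC (X a)) (frobeniusBC (Y a)).
    rewrite !big_set1 weight_diag !mul0r subrr add0r ler_wpM2l//.
    apply: (@le_trans _ _ (\sum_m w i m * (th * r))); last first.
      by rewrite -mulr_suml ler_wpM2r// mulr_ge0 ?frobenius_ge0// ltW.
    rewrite [leRHS](bigID (fun m => m \notin [set i]%SET))/= ler_wpDr//.
      apply: sumr_ge0 => m _.
      by rewrite mulr_ge0 ?weight_ge0// mulr_ge0 ?frobenius_ge0// ltW.
    apply: ler_sum => m; rewrite !inE => mi; rewrite big_set1 (YN m)//.
    rewrite -mulrBr ler_wpM2l ?weight_ge0// lerBlDr -dist.
    have -> : Y i - X m = (Y i - X i) + (X i - X m) by rewrite addrA subrK.
    exact: frobeniusD.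
  have := sX Y; rewrite !lrcc_objectiveE => opt.
  move: fus nuc => /(ler_wpM2l gamma1_ge0) fus /(ler_wpM2l gamma2_ge0) nuc.
  rewrite -(ler_pM2l th0) /G.
  move: opt data fus nuc; rewrite !mulrBr ![gamma1 * (2^-1 * _)]mulrCA.
  by lra.
have G_ge0 : 0 <= G.
  apply: addr_ge0; last by rewrite mulr_ge0// sqrtr_ge0.
  rewrite -mulrA; apply: mulr_ge0 => //; apply: le_trans sum_w.
  by apply: sumr_ge0 => j _; exact: weight_ge0.
have [r0|r_gt0] := leP r 0; first exact: le_trans r0 G_ge0.
rewrite leNgt; apply/negP => Gr.
pose th := (r - G) / r.
have th0 : 0 < th by rewrite divr_gt0// subr_gt0.
(* If [G < r], this fraction contradicts [key]: [th' / 2 * r] is only [(r - G) / 4]. *)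
pose th' := th / 2.
have th'1 : th' < 1.
  rewrite /th' /th ltr_pdivrMr// mul1r ltr_pdivrMr//; lra.
have := key th' _ th'1; rewrite divr_gt0// => /(_ isT).
rewrite expr2 mulrA ler_pM2r// leNgt => /negP; apply.
rewrite /th' /th mulrBl mul1r.
have -> : (r - G) / r / 2 / 2 * r = (r - G) / 4 by field; rewrite gt_eqF.
lra.
Qed.

End objective.

(** * Measurability of the clustering events *)

(** [D] is the pullback of an open set: it is the union of the boxes with rational centre and radius
    [m.+1%:R^-1] that it contains, and these are countably many. *)
Lemma measurable_open_in (R : realType) (d : measure_display) (T : measurableType d)
    (K : finType) (g : K -> T -> R) (D : set T) :
  (forall k, measurable_fun setT (g k)) ->
  (forall x, D x -> exists2 r, 0 < r &
     forall y, (forall k, `|g k y - g k x| < r) -> D y) ->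
  measurable D.
Proof.
move=> mg Dopen.
pose box (q : {ffun K -> rat}) (m : nat) :=
  [set y | forall k, `|g k y - ratr (q k)| < m.+1%:R^-1].
have mbox q m : measurable (box q m).
  have -> : box q m = \bigcap_(k in [set: K]) (g k @^-1`
      `]ratr (q k) - m.+1%:R^-1, ratr (q k) + m.+1%:R^-1[).
    apply/seteqP; split=> [y yb k _|y yb k].
      by have := yb k; rewrite /= in_itv/= ltr_distl.
    by have := yb k I; rewrite /= in_itv/= ltr_distl.
  apply: fin_bigcap_measurable; first exact: finite_finset.
  by move=> k _; rewrite -[X in measurable X]setTI; exact: mg.
have -> : D = \bigcup_qm (if asbool (box qm.1 qm.2 `<=` D) then box qm.1 qm.2 else set0).
  apply/seteqP; split=> [x Dx|x [[q m] _ /=]]; last by case: asboolP => // ? ?; auto.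
  have [r r0 xr] := Dopen x Dx.
  (* With this radius below [r / 2], a box containing [x] lies within [r] of [x]. *)
  have [m mr] : exists m, m.+1%:R^-1 < r / 2.
    exists (Num.truncn (r / 2)^-1); rewrite invf_plt ?posrE ?divr_gt0//.
    exact: truncnS_gt.
  have qk k : exists q : rat, `|g k x - ratr q| < m.+1%:R^-1.
    have /rat_in_itvoo[q] : g k x - m.+1%:R^-1 < g k x + m.+1%:R^-1.
      by rewrite ltrD2l gtrN.
    by rewrite in_itv/= -ltr_distl distrC => qb; exists q.
  pose q := [ffun k => projT1 (cid (qk k))].
  have xb : box q m x by move=> k; rewrite ffunE; case: cid.
  exists (q, m) => //=; case: asboolP => // -[] y yb; apply: xr => k.
  rewrite (le_lt_trans (ler_distD (ratr (q k)) _ _))//.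
  by rewrite (splitr r) ltrD// (lt_trans _ mr)//; rewrite distrC.
apply: countable_bigcupT_measurable => // -[q m].
by case: asboolP.
Qed.

Section model_measurability.
Context {R : realType} {d1 d2 n : nat} {disp : measure_display}.
Context {Omega : measurableType disp}.
Variables (A : 'I_n -> Omega -> 'M[R]_(d1, d2)).
Hypothesis mA : forall i a b, measurable_fun setT (fun om => A i om a b).

Lemma measurable_open_in_mx (D : set Omega) :
  (forall om, D om -> exists2 r, 0 < r & forall om',
     (forall i, frobenius_norm (A i om' - A i om) < r) -> D om') ->
  measurable D.
Proof.
move=> Dopen.
apply: (@measurable_open_in R _ _ ('I_n * 'I_d1 * 'I_d2)%type
  (fun k om => A k.1.1 om k.1.2 k.2)) => // om Dom.
have [r r0 rD] := Dopen om Dom.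
(* The successor keeps the divisor positive and makes the bound on the sum of entries strict. *)
pose N : R := (d1 * d2).+1%:R.
exists (r / N); first by rewrite divr_gt0.
move=> om' near_om; apply: rD => i.
apply: le_lt_trans (frobenius_le_sum _) _.
apply: (@le_lt_trans _ _ (\sum_(a < d1) \sum_(b < d2) (r / N))).
  apply: ler_sum => a _; apply: ler_sum => b _; rewrite !mxE.
  exact/ltW/(near_om (i, a, b)).
rewrite !sumr_const !card_ord -mulrnA -mulr_natl mulrCA gtr_pMr// ltr_pdivrMr//.
by rewrite mul1r ltr_nat mulnC.
Qed.

Lemma measurable_near_mean t sigma (Mu : 'M[R]_(d1, d2)) i :
  measurable [set om | i \in near_mean t sigma Mu (fun i => A i om)].
Proof.
rewrite -[X in measurable X]setCK; apply: measurableC.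
apply: measurable_open_in_mx => om /=; rewrite !inE => /negP.
rewrite -ltNge => om_far.
exists (frobenius_norm (A i om - Mu) - t * sigma); first by rewrite subr_gt0.
move=> om' /(_ i); rewrite !inE => om'_near; apply/negP; rewrite -ltNge.
have := frobeniusD (A i om - A i om') (A i om' - Mu).
rewrite addrA subrK (frobeniusBC (A i om)).
by move: om'_near; lra.
Qed.

Lemma measurable_near_mean_eq t sigma (Mu : 'M[R]_(d1, d2)) (S : {set 'I_n}) :
  measurable [set om | near_mean t sigma Mu (fun i => A i om) = S].
Proof.
set J := near_mean t sigma Mu.
have -> : [set om | J (fun i => A i om) = S] = \bigcap_(i in [set: 'I_n])
    (if i \in S then [set om | i \in J (fun i => A i om)]
     else ~` [set om | i \in J (fun i => A i om)]).
  apply/seteqP; split=> [om /= JS i _|om /= H].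
    by case: ifPn => iS /=; rewrite JS// (negbTE iS).
  apply/setP => i; have := H i I; case: ifPn => iS /=; first by move=> ->.
  by move/negP/negbTE.
apply: fin_bigcap_measurable; first exact: finite_finset.
move=> i _; case: ifPn => _; last apply: measurableC; exact: measurable_near_mean.
Qed.

Variables (e : rel 'I_n) (w : 'I_n -> 'I_n -> R) (gamma1 gamma2 : R).
Hypothesis graph : weighted_graph e w.
Hypotheses (gamma1_ge0 : 0 <= gamma1) (gamma2_ge0 : 0 <= gamma2).
Variable X : 'I_n -> Omega -> 'M[R]_(d1, d2).
Hypothesis X_sol : forall om, lrcc_solution e w gamma1 gamma2
  (fun i => A i om) (fun i => X i om).

(** Where [X i] and [X j] differ, they still differ for all nearby data, by the Lipschitz bound. *)
Lemma measurable_solution_eq i j : measurable [set om | X i om = X j om].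
Proof.
rewrite -[X in measurable X]setCK; apply: measurableC.
apply: measurable_open_in_mx => om /= Xij.
set delta := frobenius_norm (X i om - X j om).
have delta_gt0 : 0 < delta.
  rewrite lt_neqAle frobenius_ge0 andbT eq_sym; apply/eqP => /frobenius0_eq0/eqP.
  by rewrite subr_eq0 => /eqP.
pose N : R := n.+1%:R.
have N_ge1 : 1 <= N by rewrite ler1n.
(* Each solution matrix then moves by less than [delta / 2]: its squared move is at most
   [(delta / 2) ^+ 2 * (n%:R / (N * N))], and [n%:R < N]. *)
exists (delta / (4 * N)); first by rewrite divr_gt0// mulr_gt0.
move=> om' near_om Xij'.
have lip k : frobenius_norm (X k om' - X k om) < delta / 2.
  rewrite -(@ltr_pXn2r _ 2) ?nnegrE ?frobenius_ge0 ?divr_ge0 ?ltW//.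
  apply: (@le_lt_trans _ _ (\sum_k frobenius_norm (X k om' - X k om) ^+ 2)).
    by rewrite (bigD1 k)//= lerDl sumr_ge0// => l _; exact: sqr_ge0.
  have := lrcc_solution_lipschitz graph gamma1_ge0 gamma2_ge0 (X_sol om') (X_sol om).
  move=> /le_lt_trans; apply.
  apply: (@le_lt_trans _ _ (4 * \sum_(k < n) (delta / (4 * N)) ^+ 2)).
    rewrite ler_wpM2l//; apply: ler_sum => l _.
    by rewrite ler_pXn2r ?nnegrE ?frobenius_ge0 ?divr_ge0 ?mulr_ge0 ?ltW//= (lt_le_trans ltr01).
  rewrite sumr_const card_ord -[_ *+ n]mulr_natl.
  have nN : n%:R < N by rewrite ltr_nat.
  have -> : 4 * (n%:R * (delta / (4 * N)) ^+ 2) = (delta / 2) ^+ 2 * (n%:R / (N * N)).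
    by field; rewrite gt_eqF// (lt_le_trans ltr01).
  rewrite gtr_pMr ?exprn_gt0 ?divr_gt0// ltr_pdivrMr ?mulr_gt0 ?(lt_le_trans ltr01)//.
  rewrite mul1r (lt_le_trans nN)// -[leLHS]mulr1 ler_wpM2l//.
have := frobeniusD (X i om - X i om') (X i om' - X j om).
rewrite addrA subrK -/delta (frobeniusBC (X i om)) {2}Xij'.
have := lip i; have := lip j; lra.
Qed.

End model_measurability.

(** * Gaussian measures on tuples *)

Section normal_symmetries.
Context {R : realType}.
Local Notation mu := (@lebesgue_measure R).
Local Notation mR := (measurableTypeR R).

Lemma measurable_divr (c : R) : measurable_fun [set: mR] (fun x : mR => x / c : mR).
Proof. by apply: (@measurable_funM _ mR R) => //; exact: measurable_id. Qed.

Lemma lebesgue_measure_divr (c : {posnum R}) (B : set R) : measurable B ->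
  pushforward mu (fun x : mR => x / c%:num : mR) B = (c%:num%:E * mu B)%E.
Proof.
move=> mB; set f := fun x : mR => x / c%:num : mR.
have mf : measurable_fun [set: mR] f := measurable_divr c%:num.
have muE := @lebesgue_measure_unique R (mscale (c%:num^-1)%:nng (pushforward mu f)).
rewrite (muE _ mf _ B mB) /mscale/=; last first.
  move=> _ [[a b] _ <-]/=; rewrite /mscale/= /pushforward.
  have -> : f @^-1` `]a, b] = `]a * c%:num, b * c%:num]%classic.
    apply/seteqP; split=> x /=; rewrite !in_itv/= /f.
      by rewrite ltr_pdivlMr// ler_pdivrMr.
    by rewrite ltr_pdivlMr// ler_pdivrMr.
  rewrite !lebesgue_measure_itv/= !lte_fin ltr_pM2r//; case: ifPn => // _.
    rewrite -!EFinD -EFinM; congr EFin; by field.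
  by rewrite mule0.
by rewrite muleA -EFinM divff// mul1e.
Qed.

Lemma normal_prob_divr (c : {posnum R}) (B : set R) : measurable B ->
  normal_prob 0 c%:num ((fun x => x / c%:num) @^-1` B) = normal_prob 0 1 B.
Proof.
move=> mB; set f := fun x : mR => x / c%:num : mR.
have mf : measurable_fun [set: mR] f := measurable_divr c%:num.
(* The centred normal density of standard deviation [c] at [x] is [g (x / c)]; the factor [c^-1]
   cancels the scaling of Lebesgue measure by the pushforward. *)
pose g (y : R) : \bar R := (c%:num^-1 * normal_pdf 0 1 y)%:E.
have mg : measurable_fun setT g.
  apply/measurable_EFinP; apply: measurable_funM => //; exact: measurable_normal_pdf.
have g0 y : (0 <= g y)%E by rewrite lee_fin mulr_ge0 ?invr_ge0 ?normal_pdf_ge0.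
transitivity (\int[mu]_(x in f @^-1` B) (g \o f) x)%E.
  apply: eq_integral => x _; rewrite /g /= !normal_pdfE// /normal_peak /normal_fun.
  congr EFin; rewrite mulrA !subr0 !expr1n mul1r; congr (_ * expR _).
    rewrite -mulr_natr -mulrA sqrtrM ?sqr_ge0// sqrtr_sqr ger0_norm//.
    by rewrite invfM mulr_natr.
  by rewrite /f; field.
rewrite -(ge0_integral_pushforward mf)//; last exact: measurable_funTS.
rewrite (eq_measure_integral (mscale c%:num%:nng mu)); last first.
  by move=> A mA _; rewrite /= lebesgue_measure_divr.
rewrite ge0_integral_mscale//; last exact: measurable_funTS.
rewrite -ge0_integralZl//; last exact: measurable_funTS.
apply: eq_integral => x _; rewrite /g -EFinM; congr EFin.
by apply: (@mulVKf _ c%:num); rewrite gt_eqF.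
Qed.

Lemma normal_probN (B : set R) : measurable B ->
  normal_prob 0 1 (-%R @^-1` B) = normal_prob 0 1 B.
Proof.
move=> mB.
have mN : measurable_fun [set: mR] (-%R : mR -> mR).
  by apply: (@measurable_funN _ mR R) => //; exact: measurable_id.
have mg : measurable_fun setT (fun x : R => (normal_pdf 0 1 x)%:E).
  by apply/measurable_EFinP; exact: measurable_normal_pdf.
rewrite /normal_prob.
transitivity (\int[mu]_(x in (-%R : mR -> mR) @^-1` B)
    ((fun x : R => (normal_pdf 0 1 x)%:E) \o -%R) x)%E.
  apply: eq_integral => x _; rewrite /= !normal_pdfE// /normal_fun.
  by rewrite !subr0 sqrrN.
rewrite -(ge0_integral_pushforward mN)//; last 2 first.
- exact: measurable_funTS.
- by move=> y _; rewrite lee_fin normal_pdf_ge0.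
by apply: eq_measure_integral => A mA _; rewrite /= lebesgue_measureN.
Qed.

End normal_symmetries.

(** * Boxes as a generating class for measures on tuples *)

Section boxes.
Context {d : measure_display} {T : measurableType d} {n : nat}.

Definition box (B : 'I_n -> set T) : set (n.-tuple T) :=
  [set x | forall j, B j (tnth x j)].

Lemma measurable_box (B : 'I_n -> set T) :
  (forall j, measurable (B j)) -> measurable (box B).
Proof.
move=> mB; have -> : box B = \bigcap_(j in [set: 'I_n]) ((fun x => tnth x j) @^-1` B j).
  by apply/seteqP; split=> x xB j; [move=> _; exact: xB|exact: (xB j I)].
apply: fin_bigcap_measurable; first exact: finite_finset.
by move=> j _; rewrite -[X in measurable X]setTI; exact: measurable_tnth.
Qed.

(** A coordinate event is a box with all other sides full. *)
Lemma measurable_tuple_boxes :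
  @measurable _ (n.-tuple T) =
  <<s [set box B | B in [set B | forall j, measurable (B j)]] >>.
Proof.
apply/seteqP; split.
  apply: smallest_sub; first exact: smallest_sigma_algebra.
  move=> X; rewrite -bigcup_seq => -[i _ [A mA <-]].
  apply: sub_sigma_algebra; exists (fun j => if j == i then A else setT) => /=.
    by move=> j; case: ifP.
  rewrite setTI; apply/seteqP; split=> x /=.
    by move=> /(_ i); rewrite eqxx.
  by move=> Ax j; case: eqP => // ->.
apply: smallest_sub; first exact: sigma_algebra_measurable.
by move=> _ [B mB <-]; exact: measurable_box.
Qed.

Lemma tuple_measure_unique (R : realType)
    (m1 m2 : {measure set (n.-tuple T) -> \bar R}) :
  (m1 setT < +oo)%E ->
  (forall B, (forall j, measurable (B j)) -> m1 (box B) = m2 (box B)) ->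
  forall A, measurable A -> m1 A = m2 A.
Proof.
move=> m1oo m12; apply: (measure_unique
  [set box B | B in [set B | forall j, measurable (B j)]] (fun=> setT)).
- exact: measurable_tuple_boxes.
- move=> _ _ [B mB <-] [C mC <-]; exists (fun j => B j `&` C j).
    by move=> j; exact: measurableI.
  by apply/seteqP; split=> x /= => [xBC|[xB xC] j //]; split=> j; case: (xBC j).
- by move=> _; exists (fun=> setT) => //; apply/seteqP; split.
- by apply/seteqP; split=> // x _; exists 0%N.
- by move=> _ [B mB <-]; exact: m12.
- by move=> _.
Qed.

(** Uniqueness for a law restricted to an event [D]. It covers invariance under a map, with
    [D = setT] and [c = 1], as well as independence of [f] from [D], with [c] the probability of
    [D]. *)
Lemma tuple_law_unique (R : realType) (d' : measure_display)
    (Omega : measurableType d') (m : {measure set Omega -> \bar R})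
    (f : Omega -> n.-tuple T) (D : set Omega)
    (mu : {measure set (n.-tuple T) -> \bar R}) (c : {nonneg R}) :
  measurable_fun setT f -> measurable D -> (m D < +oo)%E ->
  (forall B, (forall j, measurable (B j)) ->
    m (D `&` f @^-1` box B) = (c%:num%:E * mu (box B))%E) ->
  forall C, measurable C -> m (D `&` f @^-1` C) = (c%:num%:E * mu C)%E.
Proof.
move=> mf mD Doo H C mC.
have E := @tuple_measure_unique R (pushforward (mrestr m mD) f) (mscale c mu).
rewrite setIC; apply: E => // [|B mB].
  by change (m (setT `&` D) < +oo)%E; rewrite setTI.
change (m (f @^-1` box B `&` D) = c%:num%:E * mu (box B))%E.
by rewrite setIC H.
Qed.

End boxes.

(** * Product formula and reflection symmetry of the standard Gaussian *)

Section std_gaussian.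
Context {R : realType}.
Local Notation mR := (measurableTypeR R).

Lemma probability_fineE (d : measure_display) (T : measurableType d)
    (P : probability T R) (A : set T) : measurable A -> P A = (fine (P A))%:E.
Proof. by move=> mA; rewrite fineK// fin_num_measure. Qed.

Lemma std_gaussian_box (n : nat) (B : 'I_n -> set mR) :
  (forall j, measurable (B j)) ->
  std_gaussian R n (box B) = (\prod_j fine (normal_prob 0 1 (B j)))%:E.
Proof.
elim: n B => [|n IH] B mB.
  rewrite big_ord0 /= diracE mem_set//; by case.
rewrite big_ord_recl EFinM /= /distribution /pushforward.
have -> : @cons_pair R n @^-1` box B = B ord0 `*` box (B \o lift ord0).
  apply/seteqP; split=> -[x y] /=.
    move=> xyB; split; first exact: (xyB ord0).
    by move=> j; have := xyB (lift ord0 j); rewrite tnthS.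
  move=> [xB yB] j; have [->//|[k ->]] : j = ord0 \/ exists k, j = lift ord0 k.
    by case: (unliftP ord0 j) => [k ->|->]; [right; exists k|left].
  by rewrite tnthS; exact: yB.
have mB' : forall j, measurable ((B \o lift ord0) j) by move=> j; exact: mB.
rewrite product_measure1E//=; last exact: measurable_box.
rewrite -IH// -probability_fineE//.
Qed.

Lemma std_gaussianN (n : nat) (C : set (n.-tuple mR)) : measurable C ->
  std_gaussian R n ((fun x => [tuple - tnth x i | i < n]) @^-1` C) = std_gaussian R n C.
Proof.
pose f (x : n.-tuple mR) : n.-tuple mR := [tuple - tnth x i | i < n].
have mf : measurable_fun setT f.
  apply/measurable_fun_tnthP => i.
  rewrite (_ : _ \o f = (fun x => - tnth x i)).
    apply: (@measurable_funN _ (n.-tuple mR)%type R) => //; exact: measurable_tnth.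
  by apply/funext => x /=; rewrite tnth_mktuple.
move=> mC; have oo : (std_gaussian R n setT < +oo)%E by rewrite probability_setT ltry.
have E := @tuple_law_unique _ _ n R _ _ (std_gaussian R n) f setT (std_gaussian R n)
  1%:nng mf measurableT oo.
rewrite -[RHS]mul1e -[X in _ X = _]setTI; apply: E => // B mB.
rewrite setTI mul1e.
have -> : f @^-1` box B = box (fun j => -%R @^-1` B j : set mR).
  apply/seteqP; split=> [x xB j|x xB j].
    by have := xB j; rewrite /f tnth_mktuple.
  by rewrite /f tnth_mktuple; exact: (xB j).
have mBN j : measurable (-%R @^-1` B j : set mR).
  rewrite -[X in measurable X]setTI.
  by apply: oppr_measurable; [exact: measurableT|exact: mB].
transitivity (\prod_j fine (normal_prob 0 1 (B j)))%:E; last first.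
  exact/esym/std_gaussian_box.
transitivity (\prod_j fine (normal_prob 0 1 (-%R @^-1` B j)))%:E.
  exact: std_gaussian_box mBN.
by congr EFin; apply: eq_bigr => j _; congr fine; apply: normal_probN; exact: mB.
Qed.

End std_gaussian.

(** * Counting independent events *)

Section hoeffding_bernoulli.
Context {R : realType}.

Lemma is_derive_ge0 (f f' : R -> R) :
  (forall x : R, is_derive x (1 : R) f (f' x)) -> (forall x, 0 <= x -> 0 <= f' x) ->
  f 0 = 0 -> forall x, 0 <= x -> 0 <= f x.
Proof.
move=> df f'_ge0 f0 x x0; rewrite -f0.
apply: (@ger0_derive1_le_cc R f 0 x) => //.
- by move=> y; rewrite in_itv/= => /andP[/ltW/f'_ge0]; rewrite derive1E derive_val.
- by apply: derivable_within_continuous => y _; exact: ex_derive.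
- by rewrite in_itv/= lexx.
- by rewrite in_itv/= lexx andbT.
Qed.

(** Hoeffding's lemma for a Bernoulli variable of mean [g], whose Laplace transform is [u]. The
    logarithmic gap [h] vanishes at 0 together with [h'], and its second derivative is
    nonnegative. *)
Lemma hoeffding_bernoulli (g l : R) : 0 <= g <= 1 -> 0 <= l ->
  1 + (expR (- l) - 1) * g <= expR (- l * g + l ^+ 2 / 8).
Proof.
move=> /andP[g0 g1] l0.
pose u (x : R) := 1 - g + g * expR (- x).
have u_gt0 x : 0 < u x.
  rewrite /u; have [->|gn0] := eqVneq g 0; first by rewrite subr0 mul0r addr0.
  by rewrite ltr_wpDl ?subr_ge0// mulr_gt0 ?expR_gt0// lt_neqAle eq_sym gn0.
have dexp (x : R) : is_derive x (1 : R) (fun x => expR (- x)) (- expR (- x)).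
  rewrite -[X in is_derive _ _ X]/(expR \o -%R).
  apply: is_derive_eq. by rewrite mulrN1.
have du (x : R) : is_derive x (1 : R) u (- (g * expR (- x))).
  rewrite (_ : u = cst (1 - g) + g *: (fun x => expR (- x))); last exact/funext.
  apply: is_derive_eq. by rewrite add0r scalerN.
pose h' (x : R) := x / 4 - g + g * expR (- x) / u x.
pose h (x : R) := x ^+ 2 / 8 - g * x - ln (u x).
have dh (x : R) : is_derive x (1 : R) h (h' x).
  have dln : is_derive x (1 : R) (@ln R \o u) ((u x)^-1 * (- (g * expR (- x)))).
    exact: (is_derive1_comp (is_derive1_ln (u_gt0 x)) (du x)).
  rewrite (_ : h = 8^-1 *: (id ^+ 2) - g *: id - (@ln R \o u)); last first.
    by apply/funext => y; rewrite /h [_ / 8]mulrC; reflexivity.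
  apply: is_derive_eq.
  have u_neq0 : u x != 0 by rewrite gt_eqF.
  by rewrite /h' /GRing.scale/= expr1; field.
have dV (x : R) : is_derive x (1 : R) (fun x => (u x)^-1) (g * expR (- x) / u x ^+ 2).
  have u_neq0 : u x != 0 by rewrite gt_eqF.
  have du_x : derivable u x 1 by apply: (@ex_derive _ _ _ _ _ _ _ (du x)).
  apply: DeriveDef; first exact: derivableV.
  rewrite deriveV// derive_val scalerN scaleNr opprK.
  exact: mulrC.
have dh' (x : R) : is_derive x (1 : R) h' (4^-1 - (1 - g) * (g * expR (- x)) / u x ^+ 2).
  rewrite (_ : h' = 4^-1 *: id - cst g
      + g *: ((fun x => expR (- x)) * (fun x => (u x)^-1))); last first.
    by apply/funext => y; rewrite /h' [_ / 4]mulrC -mulrA; reflexivity.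
  apply: is_derive_eq.
  have := u_gt0 x; rewrite /GRing.scale/= /u => /gt_eqF/negbT u_neq0.
by field.
have h'_ge0 x : 0 <= x -> 0 <= h' x.
  apply: (is_derive_ge0 dh') => [y _|]; last first.
    by rewrite /h' /u oppr0 expR0 mulr1 subrK mul0r add0r divr1 addrC subrr.
  rewrite subr_ge0 ler_pdivrMr ?exprn_gt0// /u.
  (* AM-GM: [(1 - g) * z] is at most a quarter of the square of [1 - g + z]. *)
  have := sqr_ge0 (1 - g - g * expR (- y)); set z := g * expR _; lra.
have h_ge0 : 0 <= h l.
  apply: (is_derive_ge0 dh) => //.
  by rewrite /h /u oppr0 expR0 mulr1 subrK ln1 expr0n/= mul0r mulr0 !subr0.
have -> : 1 + (expR (- l) - 1) * g = u l by rewrite /u; ring.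
rewrite -ler_ln ?posrE ?expR_gt0// expRK.
move: h_ge0; rewrite /h; lra.
Qed.

End hoeffding_bernoulli.

Lemma measurable_finite_law (d : measure_display) (Omega : measurableType d)
    (T : finType) (f : Omega -> T) (Q : pred T) :
  (forall x, measurable [set om | f om = x]) -> measurable [set om | Q (f om)].
Proof.
move=> mf.
have -> : [set om | Q (f om)] = \bigcup_(x in [set x | Q x]) [set om | f om = x].
  by apply/seteqP; split=> [om Qom|om [x Qx /= ->]//]; exists (f om).
by apply: fin_bigcup_measurable; first exact: finite_finset.
Qed.

Lemma prob_finite_law (R : realType) (d : measure_display) (Omega : measurableType d)
    (P : probability Omega R) (T : finType) (f : Omega -> T) (Q : pred T) :
  (forall x, measurable [set om | f om = x]) ->
  fine (P [set om | Q (f om)]) = \sum_(x | Q x) fine (P [set om | f om = x]).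
Proof.
move=> mf.
suff key (r : seq T) : uniq r ->
    measurable [set om | f om \in r] /\
    fine (P [set om | f om \in r]) = \sum_(x <- r) fine (P [set om | f om = x]).
  have [_] := key (enum Q) (enum_uniq _); rewrite big_enum => <-.
  by congr (fine (P _)); apply/seteqP; split=> om /=; rewrite mem_enum.
elim: r => [_|x r IH /= /andP[xr /IH[mr Hr]]].
  have -> : [set om | f om \in [::]] = set0 by apply/seteqP; split.
  by rewrite measure0 big_nil.
have -> : [set om | f om \in x :: r] = [set om | f om = x] `|` [set om | f om \in r].
  apply/seteqP; split=> om /=; rewrite inE; first by case/orP => [/eqP|]; [left|right].
  by case=> [->|->]; rewrite ?eqxx ?orbT.
split; first exact: measurableU.
rewrite measureU//; last first.
  by apply/seteqP; split=> // om /= [->]; rewrite (negbTE xr).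
by rewrite fineD ?fin_num_measure// big_cons Hr.
Qed.

(** Expand the product of [a + 1] over [J]; [S] records the factors where [a] is chosen, and leaving
    [J] costs a factor 0. *)
Lemma sum_subset_exp (R : comPzSemiRingType) (T : finType) (J : {set T}) (a : R) :
  \sum_(S : {set T} | S \subset J) a ^+ #|S| = (a + 1) ^+ #|J|.
Proof.
transitivity (\prod_(i in J) (a + 1)); last by rewrite prodr_const.
rewrite [RHS]big_mkcond/=.
rewrite [RHS](eq_bigr (fun i => (if i \in J then a else 0) + 1)); last first.
  by move=> i _; case: ifP => _; rewrite ?add0r.
rewrite bigA_distr/= [LHS]big_mkcond; apply: eq_bigr => S _.
rewrite -big_mkcond/=; case: ifPn => [SJ|/subsetPn[i iS iJ]].
  rewrite (eq_bigr (fun=> a)) ?prodr_const// => i iS.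
  by rewrite (fintype.subsetP SJ).
by rewrite (bigD1 i)//= (negbTE iJ) mul0r.
Qed.

(** * Generating function and lower tail of the number of occurrences *)

Section occurrences.
Context {R : realType} {d : measure_display} {Omega : measurableType d}.
Context {P : probability Omega R} {n : nat} {G : 'I_n -> set Omega} {g : R}.
Hypothesis mG : forall i, measurable (G i).
Hypothesis indepG : forall J : {set 'I_n},
  fine (P [set om | forall i, i \in J -> G i om]) = g ^+ #|J|.

Definition occurrences (om : Omega) : {set 'I_n} := finset (fun i => `[< G i om >]).

Lemma measurable_occurrences J : measurable [set om | occurrences om = J].
Proof.
have -> : [set om | occurrences om = J] =
    \bigcap_(i in [set: 'I_n]) (if i \in J then G i else ~` G i).
  apply/seteqP; split=> [om /= JS i _|om /= H].
    by case: ifPn; rewrite -JS inE => /asboolP.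
  apply/setP => i; have := H i I; rewrite inE; case: ifPn => iS /=.
    by move=> Gi; apply/asboolP.
  by move=> Gi; apply/asboolP.
apply: fin_bigcap_measurable; first exact: finite_finset.
by move=> i _; case: ifPn => _ //; exact: measurableC.
Qed.

(** Inclusion-exclusion: expanding [z ^+ #|J|] over the subsets [S] of [J] and exchanging sums
    leaves the probabilities that all events of [S] occur, the form in which independence is
    assumed. *)
Lemma occurrences_generating (z : R) :
  \sum_J fine (P [set om | occurrences om = J]) * z ^+ #|J| = (1 + (z - 1) * g) ^+ n.
Proof.
have zE (J : {set 'I_n}) : z ^+ #|J| = \sum_(S : {set 'I_n} | S \subset J) (z - 1) ^+ #|S|.
  by rewrite sum_subset_exp subrK.
under eq_bigr do rewrite zE mulr_sumr.
rewrite (exchange_big_dep predT)//=.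
transitivity (\sum_(S : {set 'I_n} | S \subset [set: 'I_n]%SET) ((z - 1) * g) ^+ #|S|).
  rewrite [RHS](eq_bigl predT); last by move=> S; rewrite finset.subsetT.
  apply: eq_bigr => S _; rewrite -mulr_suml mulrC exprMn; congr (_ * _).
  rewrite -(prob_finite_law P (fun J : {set 'I_n} => S \subset J) measurable_occurrences).
  rewrite -indepG; congr (fine (P _)); apply/seteqP; split=> om /=.
    by move=> /fintype.subsetP H i /H; rewrite inE => /asboolP.
  by move=> H; apply/fintype.subsetP => i /H Gi; rewrite inE; apply/asboolP.
by rewrite sum_subset_exp cardsT card_ord addrC.
Qed.

(** The generating function at 0, where only the empty set survives because [0 ^+ 0 = 1]. *)
Lemma prob_no_occurrence : fine (P [set om | forall i, ~ G i om]) = (1 - g) ^+ n.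
Proof.
have := occurrences_generating 0; rewrite sub0r mulN1r => <-.
rewrite (bigD1 finset.set0)//= cards0 expr0 mulr1 big1 ?addr0; last first.
  by move=> J J0; rewrite expr0n cards_eq0 (negbTE J0) mulr0.
congr (fine (P _)); apply/seteqP; split=> om /=.
  by move=> H; apply/setP => i; rewrite !inE; apply/asboolP.
by move=> /setP H i Gi; have := H i; rewrite !inE => /asboolP.
Qed.

Lemma hoeffding_occurrences (eps : R) : 0 <= g <= 1 -> 0 <= eps ->
  fine (P [set om | #|occurrences om|%:R < (g - eps) * n%:R]) <=
  expR (- 2 * eps ^+ 2 * n%:R).
Proof.
(* Chernoff's method: [4 * eps] minimises the exponent [- l * eps + l ^+ 2 / 8], with value
   [- 2 * eps ^+ 2]. *)
move=> g01 eps0; pose l := 4 * eps; have l0 : 0 <= l by rewrite mulr_ge0.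
rewrite (prob_finite_law P (fun J : {set 'I_n} => #|J|%:R < (g - eps) * n%:R)
  measurable_occurrences).
(* Markov's inequality, one value of [J] at a time: on the event,
   [expR (l * ((g - eps) * n%:R - #|J|%:R))] is at least 1. *)
apply: (@le_trans _ _ (expR (l * ((g - eps) * n%:R)) *
    (1 + (expR (- l) - 1) * g) ^+ n)).
  rewrite -occurrences_generating mulr_sumr big_mkcond/=; apply: ler_sum => J _.
  have mu0 : 0 <= fine (P [set om | occurrences om = J]) by rewrite fine_ge0.
  case: ifPn => [Jlt|_]; last by rewrite !mulr_ge0 ?expR_ge0 ?exprn_ge0// ?expR_ge0.
  rewrite mulrCA -[leLHS]mulr1 ler_wpM2l// -expRM_natl -expRD -[leLHS]expR0 ler_expR.
  by have := ler_wpM2l l0 (ltW Jlt); lra.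
apply: (@le_trans _ _ (expR (l * ((g - eps) * n%:R)) * expR (- l * g + l ^+ 2 / 8) ^+ n)).
  rewrite ler_wpM2l ?expR_ge0// lerXn2r ?nnegrE ?expR_ge0 ?hoeffding_bernoulli//.
  case/andP: g01 => g0 g1.
  have -> : 1 + (expR (- l) - 1) * g = (1 - g) + expR (- l) * g by ring.
  by rewrite addr_ge0 ?subr_ge0// mulr_ge0 ?expR_ge0.
rewrite -expRM_natl -expRD ler_expR le_eqVlt; apply/orP; left; apply/eqP.
by rewrite /l; field.
Qed.

End occurrences.

(** * Gaussian mass of balls and half balls *)

Section half_ball.
Context {R : realType} {n : nat}.
Local Notation mR := (measurableTypeR R).

Definition half_ball (t : R) (c : 'I_n -> R) : set (n.-tuple mR) :=
  [set x | tuple_norm x <= t /\ 0 <= \sum_j c j * tnth x j].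

Lemma measurable_ball t : measurable [set x : n.-tuple mR | tuple_norm x <= t].
Proof.
rewrite -[X in measurable X]setTI.
have -> : [set x : n.-tuple mR | tuple_norm x <= t] = @tuple_norm R n @^-1` `]-oo, t].
  by apply/seteqP; split=> x /=; rewrite in_itv.
by apply: measurable_tuple_norm => //; exact: measurable_itv.
Qed.

Lemma measurable_half_ball t c : measurable (half_ball t c).
Proof.
have -> : half_ball t c = [set x | tuple_norm x <= t] `&`
    ((fun x : n.-tuple mR => \sum_j c j * tnth x j) @^-1` `[0, +oo[).
  by apply/seteqP; split=> x [xt xc]; split=> //=; move: xc; rewrite /= in_itv/= andbT.
apply: measurableI; first exact: measurable_ball.
rewrite -[X in measurable X]setTI.
suff mf : measurable_fun setT (fun x : n.-tuple mR => \sum_j c j * tnth x j : R).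
  by apply: mf => //; exact: measurable_itv.
apply: measurable_sum => j; apply: measurable_funM => //; exact: measurable_tnth.
Qed.

Lemma chi_cdfE t :
  chi_cdf n t = fine (std_gaussian R n [set x | tuple_norm x <= t]).
Proof.
by congr (fine (std_gaussian R n _)).
Qed.

Lemma chi_cdf_ge0 t : 0 <= @chi_cdf R n t.
Proof. by rewrite chi_cdfE fine_ge0. Qed.

Lemma chi_cdf_le1 t : @chi_cdf R n t <= 1.
Proof.
rewrite chi_cdfE -lee_fin -probability_fineE; last exact: measurable_ball.
by apply: probability_le1; exact: measurable_ball.
Qed.

(** The half balls for [c] and [- c] cover the ball and are exchanged by the reflection. *)
Lemma std_gaussian_half_ball t c :
  chi_cdf n t / 2 <= fine (std_gaussian R n (half_ball t c)).
Proof.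
have sym : std_gaussian R n (half_ball t (fun j => - c j)) =
    std_gaussian R n (half_ball t c).
  rewrite -(std_gaussianN (measurable_half_ball t c)); congr (std_gaussian R n _).
  have normN x : tuple_norm [tuple - tnth x i | i < n] = tuple_norm x :> R.
    by congr Num.sqrt; apply: eq_bigr => i _; rewrite tnth_mktuple sqrrN.
  have dotN (x : n.-tuple mR) : \sum_j c j * tnth [tuple - tnth x i | i < n] j =
      \sum_j - c j * tnth x j :> R.
    by apply: eq_bigr => i _; rewrite tnth_mktuple mulrN mulNr.
  by apply/seteqP; split=> x; rewrite /half_ball /= normN dotN.
have cover : [set x : n.-tuple mR | tuple_norm x <= t] `<=`
    half_ball t c `|` half_ball t (fun j => - c j).
  move=> x xt; have [xc|xc] := leP 0 (\sum_j c j * tnth x j); first by left.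
  right; split=> //; rewrite (eq_bigr (fun j => - (c j * tnth x j))).
    by rewrite sumrN oppr_ge0 ltW.
  by move=> j _; rewrite mulNr.
have m1 := measurable_half_ball t c; have m2 := measurable_half_ball t (fun j => - c j).
have mb := measurable_ball t.
have le_cover : (std_gaussian R n [set x | (tuple_norm x <= t)%R] <=
    std_gaussian R n (half_ball t c) + std_gaussian R n (half_ball t (fun j => (- c j)%R)))%E.
  apply: le_trans (measureU2 _ m1 m2).
  by apply: le_measure => //; rewrite inE//; exact: measurableU.
move: le_cover; rewrite sym (probability_fineE _ mb) (probability_fineE _ m1) -EFinD lee_fin.
by rewrite chi_cdfE; lra.
Qed.

End half_ball.

(** * Comparison of the product bound with the union bound *)

Section numeric_bound.
Context {R : realType}.

Lemma ln2_le1 : ln 2 <= 1 :> R.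
Proof. by have := @le_ln1Dx R 1; apply; lra. Qed.

(* AM-GM: the right-hand side is at least twice the geometric mean of its terms,
   and [ln 2 <= 1] makes that mean at least [expR (- (a / 2) * n)]. *)
Lemma expR_powR_ge (a eps : R) (n : nat) : 0 <= eps -> eps <= 2^-1 ->
  eps <= a -> a <= 1 ->
  2 * (1 - a / 2) ^+ n <= expR (- 2 * eps ^+ 2 * n%:R) + 2 `^ (- ((a - eps) * n%:R)).
Proof.
move=> eps0 eps2 eps_a a1.
set x := expR _; set y := 2 `^ _; set z := (1 - a / 2) ^+ n.
have x0 : 0 <= x := expR_ge0 _; have y0 : 0 <= y := powR_ge0 _ _.
have z0 : 0 <= z by rewrite exprn_ge0//; lra.
(* Per observation, the exponent of [x * y] is at least [- 2 * eps ^+ 2 - (a - eps)], which is [- a]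
   plus the slack [eps * (1 - 2 * eps)]. *)
have zxy : z ^+ 2 <= x * y.
  apply: (@le_trans _ _ (expR (- (a / 2)) ^+ n ^+ 2)).
    apply: lerXn2r; rewrite ?nnegrE ?exprn_ge0 ?expR_ge0//; first lra.
    apply: lerXn2r; rewrite ?nnegrE ?expR_ge0//; first lra.
    exact: expR_ge1Dx.
  rewrite -!expRM_natl /y /powR ifF ?pnatr_eq0// -expRD ler_expR.
  have ln_le := ler_wpM2l (_ : 0 <= (a - eps) * n%:R) ln2_le1.
  have {ln_le} := ln_le (mulr_ge0 _ (ler0n _ _)); rewrite subr_ge0 => /(_ eps_a) ln_le.
  have : 0 <= eps * (1 - 2 * eps) * n%:R by rewrite !mulr_ge0//; lra.
  by move: ln_le; set lg := ln 2; lra.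
rewrite -(@ler_pXn2r _ 2) ?nnegrE ?mulr_ge0 ?addr_ge0//.
by have := sqr_ge0 (x - y); move: zxy; lra.
Qed.

(** The product of two numbers in the unit interval is at most their mean, and half of each error
    term dominates the failure probability of one search. *)
Lemma product_le_union_bound (a b eps : R) (n : nat) :
  0 <= eps -> a + b <= 1 -> 0 <= a -> 0 <= b ->
  let q c : R := 1 - expR (- 2 * eps ^+ 2 * n%:R) - 2 `^ (- ((c - eps) * n%:R)) in
  0 < q a -> 0 < q b ->
  q a * q b <= 1 - (1 - a / 2) ^+ n - (1 - b / 2) ^+ n.
Proof.
move=> eps0 ab a0 b0 q qa qb.
have x0 := expR_ge0 (- 2 * eps ^+ 2 * n%:R).
(* If [c < eps], the power of 2 is at least 1 and [q c] cannot be positive. *)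
have eps_lt c : 0 < q c -> eps <= c.
  rewrite /q => qc; rewrite leNgt; apply/negP => ceps.
  suff : 1 <= 2 `^ (- ((c - eps) * n%:R)) :> R by lra.
  rewrite -[leLHS](powRr0 2) ler_powR//; first lra.
  by rewrite oppr_ge0 nmulr_rle0// subr_lt0.
have ea := eps_lt a qa; have eb := eps_lt b qb.
have eps2 : eps <= 2^-1 by lra.
have a1 : a <= 1 by lra.
have b1 : b <= 1 by lra.
have ha := expR_powR_ge n eps0 eps2 ea a1.
have hb := expR_powR_ge n eps0 eps2 eb b1.
have ya : 0 <= 2 `^ (- ((a - eps) * n%:R)) :> R := powR_ge0 _ _.
have yb : 0 <= 2 `^ (- ((b - eps) * n%:R)) :> R := powR_ge0 _ _.
(* Adding [h] and [h'] bounds the product by the mean. *)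
have h : 0 <= (1 - q a) * q b by rewrite mulr_ge0 ?(ltW qb)// /q; lra.
have h' : 0 <= (1 - q b) * q a by rewrite mulr_ge0 ?(ltW qa)// /q; lra.
have : q a * q b <= (q a + q b) / 2 by lra.
by move/le_trans; apply; rewrite /q; lra.
Qed.

End numeric_bound.

(** * The low rank mixture model *)

Section mixture.
Context {R : realType} {d1 d2 n K : nat} {disp : measure_display}.
Context {Omega : measurableType disp} {P : probability Omega R}.
Context {M : 'I_K -> 'M[R]_(d1, d2)} {p : 'I_K -> R} {sigma : R}.
Context {s : 'I_n -> Omega -> 'I_K} {E : 'I_n -> 'I_d1 -> 'I_d2 -> {RV P >-> R}}.
Context {A : 'I_n -> Omega -> 'M[R]_(d1, d2)}.
Hypothesis model : low_rank_mixture M p sigma s E A.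
Hypothesis sigma_gt0 : 0 < sigma.
Local Notation mR := (measurableTypeR R).

(** Division by [sigma] makes the law [std_gaussian], whose norm defines [chi_cdf]. *)
Definition std_noise i (om : Omega) : (d1 * d2).-tuple mR :=
  [tuple mxvec (\matrix_(a < d1, b < d2) E i a b om) 0 j / sigma | j < d1 * d2].

Lemma tnth_std_noise i om a b :
  tnth (std_noise i om) (mxvec_index a b) = E i a b om / sigma.
Proof. by rewrite tnth_mktuple mxvecE mxE. Qed.

Lemma measurable_std_noise i : measurable_fun setT (std_noise i).
Proof.
apply/measurable_fun_tnthP => j; case/mxvec_indexP: j => a b.
rewrite (_ : _ \o _ = (fun om => E i a b om / sigma)).
  by apply: measurable_funM => //; exact: measurable_funPT.
by apply/funext => om /=; rewrite tnth_std_noise.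
Qed.

Lemma prod_mxvec_index (F : 'I_(d1 * d2) -> R) :
  \prod_j F j = \prod_(a < d1) \prod_(b < d2) F (mxvec_index a b).
Proof.
rewrite pair_bigA/= (reindex (uncurry (@mxvec_index d1 d2))) /=.
  by apply: eq_bigr => -[a b].
exact: curry_mxvec_bij.
Qed.

Lemma measurable_label i (L : set 'I_K) : measurable (s i @^-1` L).
Proof.
have -> : s i @^-1` L = \bigcup_(k in L) [set om | s i om = k].
  by apply/seteqP; split=> [om Lom|om [k Lk /= sk]]; [exists (s i om)|rewrite /= sk].
apply: fin_bigcup_measurable; first exact: finite_finset.
by move=> k _; exact: (lrm_label_meas model).
Qed.

(** [D] selects the constrained noise blocks: the extension of independence needs the event with one
    block left free. *)
Lemma measurable_blocks (L : 'I_n -> set 'I_K)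
    (C : 'I_n -> set ((d1 * d2).-tuple mR)) (D : set 'I_n) :
  (forall i, measurable (C i)) ->
  measurable [set om | forall i, L i (s i om) /\ (D i -> C i (std_noise i om))].
Proof.
move=> mC.
have -> : [set om | forall i, L i (s i om) /\ (D i -> C i (std_noise i om))] =
    \bigcap_(i in [set: 'I_n]) (s i @^-1` L i) `&`
    \bigcap_(i in D) (std_noise i @^-1` C i).
  apply/seteqP; split=> [om H|om [H1 H2] i].
    by split=> i Di; have [] := H i => // _; apply.
  by split; [exact: H1|exact: H2].
apply: measurableI; apply: fin_bigcap_measurable; try exact: finite_finset.
  by move=> i _; exact: measurable_label.
move=> i _; rewrite -[X in measurable X]setTI.
by apply: measurable_std_noise => //; exact: mC.
Qed.

Lemma independent_boxes (L : 'I_n -> set 'I_K)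
    (B : 'I_n -> 'I_(d1 * d2) -> set mR) :
  (forall i j, measurable (B i j)) ->
  fine (P [set om | forall i, L i (s i om) /\ box (B i) (std_noise i om)]) =
  (\prod_i fine (P (s i @^-1` L i))) *
  \prod_i fine (std_gaussian R (d1 * d2) (box (B i))).
Proof.
move=> mB.
pose B' i a b := (fun x : R => x / sigma) @^-1` B i (mxvec_index a b).
have mB' i a b : measurable (B' i a b).
  by rewrite -[X in measurable X]setTI; apply: (@measurable_divr R sigma).
have -> : [set om | forall i, L i (s i om) /\ box (B i) (std_noise i om)] =
    [set om | forall i, L i (s i om) /\ forall a b, B' i a b (E i a b om)].
  apply/seteqP; split=> om H i; have [Li Bi] := H i; split=> //.
    by move=> a b; rewrite /B' /= -tnth_std_noise.
  by move=> j; case/mxvec_indexP: j => a b; rewrite tnth_std_noise; exact: Bi.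
rewrite (lrm_independent model)//; congr (_ * _); apply: eq_bigr => i _.
rewrite std_gaussian_box//= prod_mxvec_index; apply: eq_bigr => a _.
apply: eq_bigr => b _; congr fine.
rewrite -[LHS]/(distribution P (E i a b) (B' i a b)) (lrm_noise_law model)//.
exact: (normal_prob_divr (PosNum sigma_gt0) (mB i _)).
Qed.

(* The independence postulated for boxes extends to arbitrary measurable sets
   of noise matrices, one observation at a time. *)
Lemma independent_blocks (L : 'I_n -> set 'I_K)
    (C : 'I_n -> set ((d1 * d2).-tuple mR)) :
  (forall i, measurable (C i)) ->
  fine (P [set om | forall i, L i (s i om) /\ C i (std_noise i om)]) =
  (\prod_i fine (P (s i @^-1` L i))) *
  \prod_i fine (std_gaussian R (d1 * d2) (C i)).
Proof.
move=> mC.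
(* Induction on [k] frees one block at a time from being a box: [boxed 0] is the postulated case,
   and [boxed n] is no restriction. *)
pose boxed k (C : 'I_n -> set ((d1 * d2).-tuple mR)) := forall i : 'I_n, (k <= i)%N ->
  exists2 B : 'I_(d1 * d2) -> set mR, (forall j, measurable (B j)) & C i = box B.
suff key k : (k <= n)%N -> forall C, (forall i, measurable (C i)) -> boxed k C ->
    fine (P [set om | forall i, L i (s i om) /\ C i (std_noise i om)]) =
    (\prod_i fine (P (s i @^-1` L i))) *
    \prod_i fine (std_gaussian R (d1 * d2) (C i)).
  by apply: (key n) => // i; rewrite leqNgt ltn_ord.
elim: k {C mC} => [_|k IH kn] C mC Cbox.
  have Cb i : {B : 'I_(d1 * d2) -> set mR | (forall j, measurable (B j)) & C i = box B}.
    exact/cid2/Cbox.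
  have -> : C = fun i => box (s2val (Cb i)).
    by apply/funext => i; exact: (s2valP' (Cb i)).
  by apply: independent_boxes => i; exact: (s2valP (Cb i)).
pose i0 := Ordinal kn.
(* [D] constrains the labels and every noise block but [i0]. Both sides are then measures in block
   [i0], which agree on boxes by induction; [c] is the probability of [D] predicted by
   independence. *)
pose D := [set om | forall i, L i (s i om) /\
  ([set i | i != i0] i -> C i (std_noise i om))].
have mD : measurable D by exact: measurable_blocks.
pose c : R := (\prod_i fine (P (s i @^-1` L i))) *
  \prod_(i | i != i0) fine (std_gaussian R (d1 * d2) (C i)).
have c_ge0 : 0 <= c.
  by rewrite mulr_ge0// prodr_ge0// => i _; rewrite fine_ge0.
have splitD C' : (forall i, i != i0 -> C' i = C i) ->
    [set om | forall i, L i (s i om) /\ C' i (std_noise i om)] =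
    D `&` std_noise i0 @^-1` C' i0.
  move=> C'E; apply/seteqP; split=> [om H|om [H1 H2] i].
    split; last by have [] := H i0.
    by move=> i; have [? ?] := H i; split=> // /= /C'E <-.
  have [Li Ci] := H1 i; split=> //; have [->//|ii0] := eqVneq i i0.
  by rewrite C'E//; exact: Ci.
have prodD C' : (forall i, i != i0 -> C' i = C i) ->
    (\prod_i fine (P (s i @^-1` L i))) *
      \prod_i fine (std_gaussian R (d1 * d2) (C' i)) =
    c * fine (std_gaussian R (d1 * d2) (C' i0)).
  move=> C'E; rewrite [X in _ * X](bigD1 i0)//= mulrCA mulrC; congr (_ * _ * _).
  by apply: eq_bigr => i /C'E ->.
rewrite prodD// splitD//.
have law := @tuple_law_unique _ mR (d1 * d2) R _ _ P (std_noise i0) D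
  (std_gaussian R (d1 * d2)) (NngNum c_ge0) (measurable_std_noise i0) mD.
rewrite law//=; first by rewrite fineM// fin_num_measure.
  by rewrite (le_lt_trans (probability_le1 _ _)) ?ltry.
move=> B mB; pose C' i := if i == i0 then box B else C i.
have C'E i : i != i0 -> C' i = C i by rewrite /C' => /negbTE ->.
have C'0 : C' i0 = box B by rewrite /C' eqxx.
have mC' i : measurable (C' i).
  by rewrite /C'; case: ifP => // _; exact: measurable_box.
have C'box : boxed k C'.
  move=> i ki; rewrite /C'; case: eqVneq => [_|ii0]; first by exists B.
  apply: Cbox; rewrite ltn_neqAle ki andbT.
  by apply: contra ii0 => /eqP ki0; apply/eqP/val_inj.
have := IH (ltnW kn) C' mC' C'box.
rewrite prodD// splitD// C'0 => H.
rewrite probability_fineE; last by apply: measurableI => //; rewrite -[X in measurable X]setTI;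
  apply: measurable_std_noise => //; exact: measurable_box.
by rewrite H EFinM -probability_fineE//; exact: measurable_box.
Qed.

Definition near_event k (C : set ((d1 * d2).-tuple mR)) i : set Omega :=
  [set om | s i om = k /\ C (std_noise i om)].

Lemma measurable_near_event k C i : measurable C -> measurable (near_event k C i).
Proof.
move=> mC; apply: measurableI; first exact: (lrm_label_meas model).
by rewrite -[X in measurable X]setTI; exact: measurable_std_noise.
Qed.

(** Labels and blocks outside [J] are constrained by [setT], so they contribute factors 1. *)
Lemma near_event_independent k C (J : {set 'I_n}) : measurable C ->
  fine (P [set om | forall i, i \in J -> near_event k C i om]) =
  (p k * fine (std_gaussian R (d1 * d2) C)) ^+ #|J|.
Proof.
move=> mC; pose L i : set 'I_K := if i \in J then [set k] else setT.
pose C' i : set ((d1 * d2).-tuple mR) := if i \in J then C else setT.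
have mC' i : measurable (C' i) by rewrite /C'; case: ifP.
have -> : [set om | forall i, i \in J -> near_event k C i om] =
    [set om | forall i, L i (s i om) /\ C' i (std_noise i om)].
  apply/seteqP; split=> om /= H i; last first.
    by move=> iJ; have := H i; rewrite /L /C' iJ.
  by rewrite /L /C'; case: ifPn => // iJ; exact: H.
rewrite independent_blocks// -big_split/= -prodr_const [RHS]big_mkcond/=.
apply: eq_bigr => i _; rewrite /L /C'; case: ifPn => _.
  by rewrite -[s i @^-1` _]/[set om | s i om = k] (lrm_label_law model).
by rewrite preimage_setT !probability_setT mulr1.
Qed.

Lemma frobenius_noise k i om : s i om = k ->
  frobenius_norm (A i om - M k) = sigma * tuple_norm (std_noise i om).
Proof.
move=> sk; rewrite (lrm_obs model) sk addrC addKr.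
rewrite -[sigma in RHS]ger0_norm ?ltW// -sqrtr_sqr -sqrtrM ?sqr_ge0//.
congr Num.sqrt; rewrite mulr_sumr.
transitivity (\sum_(a < d1) \sum_(b < d2)
    sigma ^+ 2 * tnth (std_noise i om) (mxvec_index a b) ^+ 2).
  apply: eq_bigr => a _; apply: eq_bigr => b _.
  by rewrite tnth_std_noise !mxE -exprMn mulrC divfK// gt_eqF.
rewrite pair_bigA/= [RHS](reindex (uncurry (@mxvec_index d1 d2))) /=.
  by apply: eq_bigr => -[a b].
exact: curry_mxvec_bij.
Qed.

Lemma near_event_near_mean t k C i om :
  C `<=` [set x | tuple_norm x <= t] -> near_event k C i om ->
  i \in near_mean t sigma (M k) (fun i => A i om).
Proof.
move=> Ct [sk Ci]; rewrite inE (frobenius_noise sk) [leLHS]mulrC ler_pM2r//.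
exact: (Ct _ Ci).
Qed.

Lemma half_ball_dot t k (D : 'M[R]_(d1, d2)) i om :
  near_event k (half_ball t (mxvec D 0)) i om -> 0 <= mxdot D (A i om - M k).
Proof.
move=> [sk [_]]; rewrite (lrm_obs model) sk addrC addKr.
have -> : \sum_j mxvec D 0 j * tnth (std_noise i om) j =
    mxdot D (\matrix_(a < d1, b < d2) E i a b om) / sigma.
  rewrite /mxdot mulr_suml; under [RHS]eq_bigr do rewrite mulr_suml.
  rewrite pair_bigA/= (reindex (uncurry (@mxvec_index d1 d2))) /=.
    by apply: eq_bigr => -[a b] _ /=; rewrite tnth_std_noise mxvecE !mxE mulrA.
  exact: curry_mxvec_bij.
by rewrite pmulr_lge0 ?invr_gt0.
Qed.

(** The mean is a finite combination of indicators of the label events. *)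
Lemma measurable_obs i a b : measurable_fun setT (fun om => A i om a b).
Proof.
have -> : (fun om => A i om a b) =
    (fun om => \sum_k M k a b * \1_([set om | s i om = k]) om + E i a b om).
  apply/funext => om; rewrite (lrm_obs model) !mxE (bigD1 (s i om))//= big1.
    by rewrite indicE mem_set// mulr1 addr0.
  by move=> k ks; rewrite indicE memNset ?mulr0//= => sk; rewrite sk eqxx in ks.
apply: measurable_funD; last exact: measurable_funPT.
apply: measurable_sum => k; apply: measurable_funM => //.
by apply: measurable_indic; exact: (lrm_label_meas model).
Qed.

Lemma weight_chi_le1 k t : 0 <= chi_cdf (d1 * d2) t * p k <= 1.
Proof.
have p_ge0 := lrm_weight_ge0 model.
rewrite mulr_ge0 ?chi_cdf_ge0//= mulr_ile1 ?chi_cdf_ge0 ?chi_cdf_le1//.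
by rewrite -(lrm_weight_sum model) (bigD1 k)//= lerDl sumr_ge0.
Qed.

(** * Probabilities of the two clustering events *)

Section events.
Variables (e : rel 'I_n) (w : 'I_n -> 'I_n -> R) (gamma1 gamma2 : R).
Hypothesis graph : weighted_graph e w.
Hypotheses (gamma1_ge0 : 0 <= gamma1) (gamma2_ge0 : 0 <= gamma2).
Variable X : 'I_n -> Omega -> 'M[R]_(d1, d2).
Hypothesis X_sol : forall om, lrcc_solution e w gamma1 gamma2
  (fun i => A i om) (fun i => X i om).
Variables (t eps : R).
Hypothesis eps_ge0 : 0 <= eps.
Let I k om : {set 'I_n} := near_mean t sigma (M k) (fun i => A i om).
Let N k : R := (chi_cdf (d1 * d2) t * p k - eps) * n%:R.

Lemma same_cluster_prob k : with_prob_ge P (1 - expR (- 2 * eps ^+ 2 * n%:R))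
  [set om |
    (forall i j, i \in I k om -> j \in I k om -> i != j ->
       e i j /\ eta w (I k om) i j < N k) ->
    (forall i j, i \in I k om -> j \in I k om -> i != j ->
       2 * t * sigma / (w i j * (N k - eta w (I k om) i j)) <= gamma1) ->
    forall i j, i \in I k om -> j \in I k om -> X i om = X j om].
Proof.
set V := [set om | _].
pose cond (S : {set 'I_n}) :=
  (forall i j, i \in S -> j \in S -> i != j -> e i j /\ eta w S i j < N k) /\
  (forall i j, i \in S -> j \in S -> i != j ->
     2 * t * sigma / (w i j * (N k - eta w S i j)) <= gamma1).
have mV : measurable V.
  (* The random set [I k om] takes finitely many values [S]; once it is fixed, the two conditions no
     longer depend on [om]. *)
  have -> : V = \bigcup_(S in [set: {set 'I_n}]) ([set om | I k om = S] `&`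
      (if `[< cond S >] then
         \bigcap_(ij in [set ij : 'I_n * 'I_n | ij.1 \in S /\ ij.2 \in S])
           [set om | X ij.1 om = X ij.2 om]
       else setT)).
    apply/seteqP; split=> [om Vom|om [S _ [/= IS]]].
      exists (I k om) => //; split=> //; case: asboolP => // -[c1 c2] [i j] /= [iI jI].
      exact: Vom.
    rewrite /V /= IS; case: asboolP => [_ XS _ _ i j iS jS|ncond _ c1 c2].
      exact: (XS (i, j)).
    by case: ncond.
  apply: fin_bigcup_measurable; first exact: finite_finset.
  move=> S _; apply: measurableI.
    exact: (measurable_near_mean_eq measurable_obs).
  case: ifP => // _; apply: fin_bigcap_measurable; first exact: finite_finset.
  move=> [i j] _.
  exact: (measurable_solution_eq measurable_obs graph gamma1_ge0 gamma2_ge0 X_sol).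
split=> //.
pose ball : set ((d1 * d2).-tuple mR) := [set x | tuple_norm x <= t].
have mball : measurable ball := measurable_ball t.
pose G := near_event k ball.
have mG i : measurable (G i) by exact: measurable_near_event.
have indepG (J : {set 'I_n}) : fine (P [set om | forall i, i \in J -> G i om]) =
    (chi_cdf (d1 * d2) t * p k) ^+ #|J|.
  by rewrite near_event_independent// chi_cdfE mulrC.
have hoeff := hoeffding_occurrences mG indepG (weight_chi_le1 k t) eps_ge0.
set few := [set om | _] in hoeff.
have mfew : measurable few.
  apply: (measurable_finite_law (fun J : {set 'I_n} => #|J|%:R < N k)).
  exact: measurable_occurrences.
have fewV : ~` few `<=` V.
  move=> om /= /negP; rewrite -leNgt => many c1 c2.
  apply: (lrcc_solution_fused graph gamma1_ge0 gamma2_ge0 (X_sol om)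
    (Mu := M k) (rho := t * sigma) (N := N k)) => //.
  - by move=> i; rewrite inE.
  (* The ball may also contain observations with other labels; those labelled [k] with small noise
     already suffice for the lower bound. *)
  - apply: (le_trans many); rewrite ler_nat subset_leq_card//.
    apply/fintype.subsetP => i; rewrite inE => /asboolP.
    exact: near_event_near_mean.
  - by move=> i j iI jI ij; rewrite mulrA; exact: c2.
apply: (@le_trans _ _ (P (~` few))); last first.
  by apply: le_measure => //; rewrite inE//; exact: measurableC.
by rewrite probability_setC// (probability_fineE _ mfew) -EFinB lee_fin lerD2l lerN2.
Qed.

Lemma different_cluster_prob alpha beta : alpha != beta ->
  let q k : R := 1 - expR (- 2 * eps ^+ 2 * n%:R) - 2 `^ (- N k) in
  0 <= q alpha \/ 0 <= q beta ->
  gamma1 * (n%:R - 1) * max_weight e w + gamma2 * Num.sqrt d2%:R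
    < 2^-1 * frobenius_norm (M alpha - M beta) ->
  with_prob_ge P (q alpha * q beta)
    [set om | exists i j,
      [/\ i \in I alpha om, j \in I beta om & X i om <> X j om]].
Proof.
move=> ab q q_ge0 sep; set V := [set om | _].
have mV : measurable V.
  have -> : V = \bigcup_(ij in [set: 'I_n * 'I_n])
      ([set om | ij.1 \in I alpha om] `&` [set om | ij.2 \in I beta om]
       `&` ~` [set om | X ij.1 om = X ij.2 om]).
    apply/seteqP; split=> [om [i [j [iI jI ij]]]|om [[i j] _ /= [[iI jI] ij]]].
      by exists (i, j).
    by exists i, j.
  apply: fin_bigcup_measurable; first exact: finite_finset.
  move=> [i j] _; apply: measurableI; last first.
    apply: measurableC.
    exact: (measurable_solution_eq measurable_obs graph gamma1_ge0 gamma2_ge0 X_sol).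
  apply: measurableI; exact: (measurable_near_mean measurable_obs).
split=> //.
have [qab|qab] := leP (q alpha * q beta) 0.
  by apply: le_trans (measure_ge0 P V); rewrite lee_fin.
(* Two negative factors would also have a positive product; the sign hypothesis rules this out. *)
have [qa qb] : 0 < q alpha /\ 0 < q beta.
  have [qa0 qb0] : q alpha != 0 /\ q beta != 0.
    by apply/andP; rewrite -negb_or -mulf_eq0 gt_eqF.
  case: q_ge0; rewrite le_eqVlt eq_sym.
    by rewrite (negbTE qa0)/= => qa; split=> //; move: qab; rewrite pmulr_rgt0.
  by rewrite (negbTE qb0)/= => qb; split=> //; move: qab; rewrite pmulr_lgt0.
pose D := M alpha - M beta.
(* Opposite directions, so that along [D] the noise does not bring the two observations closer. *)
pose Ga := near_event alpha (half_ball t (mxvec D 0)).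
pose Gb := near_event beta (half_ball t (mxvec (- D) 0)).
have mGa i : measurable (Ga i) by apply: measurable_near_event; exact: measurable_half_ball.
have mGb i : measurable (Gb i) by apply: measurable_near_event; exact: measurable_half_ball.
have GV om : (exists i, Ga i om) -> (exists j, Gb j om) -> V om.
  move=> [i Gi] [j Gj]; exists i, j; split.
  - by apply: (near_event_near_mean _ Gi) => x [].
  - by apply: (near_event_near_mean _ Gj) => x [].
  have := half_ball_dot Gi; have := half_ball_dot Gj.
  have := lrcc_solution_close graph gamma1_ge0 gamma2_ge0 i (X_sol om).
  have := lrcc_solution_close graph gamma1_ge0 gamma2_ge0 j (X_sol om).
  set bound := _ + _ in sep *; move=> clj cli dj di Xij.
  (* A common value of [X i] and [X j] lies within less than half of [||D||] from both
     observations. *)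
  have AA : frobenius_norm (A i om - A j om) < frobenius_norm D.
    have -> : A i om - A j om = - (X i om - A i om) + (X j om - A j om).
      by rewrite -Xij opprB addrA subrK.
    apply: le_lt_trans (frobeniusD _ _) _; rewrite frobeniusN.
    by move: sep; rewrite -/D; lra.
  have D_gt0 : 0 < frobenius_norm D := le_lt_trans (frobenius_ge0 _) AA.
  have DA : frobenius_norm D ^+ 2 <= mxdot D (A i om - A j om).
    have -> : A i om - A j om = (A i om - M alpha) - (A j om - M beta) + D.
      by rewrite /D; apply/matrixP => a b; rewrite !mxE; ring.
    rewrite mxdotDr mxdotBr frobenius_sq lerDr.
    by move: di dj; rewrite mxdotNl; lra.
  have := le_trans DA (mxdot_le _ _).
  by rewrite expr2 ler_pM2l// leNgt AA.
(* Distinct labels have total weight at most 1; this keeps [eps] at most one half in the numerical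
   bound. *)
have weight_sum : chi_cdf (d1 * d2) t * p alpha + chi_cdf (d1 * d2) t * p beta <= 1.
  have p_ge0 := lrm_weight_ge0 model.
  rewrite -mulrDr mulr_ile1 ?chi_cdf_ge0 ?chi_cdf_le1 ?addr_ge0//.
  rewrite -(lrm_weight_sum model) (bigD1 alpha)//= (bigD1 beta)/= 1?eq_sym//.
  by rewrite addrA lerDl sumr_ge0.
have none k c : fine (P [set om | forall i, ~ near_event k (half_ball t c) i om]) <=
    (1 - chi_cdf (d1 * d2) t * p k / 2) ^+ n.
  have mH := @measurable_half_ball R _ t c.
  rewrite (prob_no_occurrence (fun i => measurable_near_event k i mH)
    (fun J => near_event_independent k J mH)).
  have p_ge0 := lrm_weight_ge0 model.
  have p_le1 : p k <= 1 by rewrite -(lrm_weight_sum model) (bigD1 k)//= lerDl sumr_ge0.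
  have H_le1 : fine (std_gaussian R (d1 * d2) (half_ball t c)) <= 1.
    by rewrite -lee_fin -probability_fineE//; exact: probability_le1.
  apply: lerXn2r; rewrite ?nnegrE ?subr_ge0.
  - by rewrite mulr_ile1// fine_ge0.
  - by have /andP[] := weight_chi_le1 k t; lra.
  - by rewrite lerD2l lerN2 mulrAC mulrC ler_wpM2l// std_gaussian_half_ball.
pose noa := [set om | forall i, ~ Ga i om]; pose nob := [set om | forall i, ~ Gb i om].
have mno G : (forall i : 'I_n, measurable (G i)) ->
    measurable [set om : Omega | forall i, ~ G i om].
  move=> mG; have -> : [set om | forall i, ~ G i om] = \bigcap_(i in [set: 'I_n]) ~` G i.
    by apply/seteqP; split=> om H i; [move=> _; exact: H|exact: (H i)].
  apply: fin_bigcap_measurable; first exact: finite_finset.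
  by move=> i _; exact: measurableC.
have mnoa : measurable noa := mno _ mGa; have mnob : measurable nob := mno _ mGb.
have noV : ~` (noa `|` nob) `<=` V.
  move=> om /= /not_orP[/existsNP[i Gi] /existsNP[j Gj]].
  by apply: GV; [exists i|exists j]; exact: contrapT.
apply: (@le_trans _ _ (P (~` (noa `|` nob)))); last first.
  by apply: le_measure => //; rewrite inE//; apply: measurableC; exact: measurableU.
have mU := measurableU _ _ mnoa mnob.
rewrite probability_setC// (probability_fineE _ mU) -EFinB lee_fin.
have le_union : fine (P (noa `|` nob)) <= fine (P noa) + fine (P nob).
  by rewrite -lee_fin EFinD -!probability_fineE//; exact: measureU2.
have [a0 _] := andP (weight_chi_le1 alpha t); have [b0 _] := andP (weight_chi_le1 beta t).
have := product_le_union_bound eps_ge0 weight_sum a0 b0 qa qb.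
have := none alpha (mxvec D 0); have := none beta (mxvec (- D) 0).
move: le_union; rewrite -/Ga -/Gb -/noa -/nob -/(q _) -/(q _); lra.
Qed.

End events.

End mixture.

Theorem theorem2p3 (R : realType) (d1 d2 n K : nat)
    (d2_gt0 : (0 < d2)%N) (d2_le_d1 : (d2 <= d1)%N)
    (disp : measure_display) (Omega : measurableType disp)
    (P : probability Omega R)
    (M : 'I_K -> 'M[R]_(d1, d2)) (p : 'I_K -> R) (sigma : R)
    (sigma_gt0 : 0 < sigma)
    (s : 'I_n -> Omega -> 'I_K)
    (E : 'I_n -> 'I_d1 -> 'I_d2 -> {RV P >-> R})
    (A : 'I_n -> Omega -> 'M[R]_(d1, d2))
    (model : low_rank_mixture M p sigma s E A)
    (e : rel 'I_n) (w : 'I_n -> 'I_n -> R) (graph : weighted_graph e w)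
    (gamma1 gamma2 : R) (gamma1_gt0 : 0 < gamma1) (gamma2_gt0 : 0 < gamma2)
    (X : 'I_n -> Omega -> 'M[R]_(d1, d2))
    (X_sol : forall om, lrcc_solution e w gamma1 gamma2
               (fun i => A i om) (fun i => X i om))
    (t : R) (t_gt0 : 0 < t) (alpha : 'I_K)
    (eps : R) (eps_gt0 : 0 < eps)
    (eps_lt : eps < chi_cdf (d1 * d2) t * p alpha) :
  let I (k : 'I_K) (om : Omega) : {set 'I_n} :=
    near_mean t sigma (M k) (fun i => A i om) in
  let N (k : 'I_K) : R := (chi_cdf (d1 * d2) t * p k - eps) * n%:R in
  let q (k : 'I_K) : R :=
    1 - expR (- 2 * eps ^+ 2 * n%:R) - 2 `^ (- N k) in
  with_prob_ge P (1 - expR (- 2 * eps ^+ 2 * n%:R))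
    [set om |
      (forall i j, i \in I alpha om -> j \in I alpha om -> i != j ->
         e i j /\ eta w (I alpha om) i j < N alpha) ->
      (forall i j, i \in I alpha om -> j \in I alpha om -> i != j ->
         2 * t * sigma / (w i j * (N alpha - eta w (I alpha om) i j))
         <= gamma1) ->
      forall i j, i \in I alpha om -> j \in I alpha om -> X i om = X j om]
  /\
  (forall beta : 'I_K, beta != alpha ->
     0 <= q alpha \/ 0 <= q beta ->
     gamma1 * (n%:R - 1) * max_weight e w + gamma2 * Num.sqrt d2%:R
       < 2^-1 * frobenius_norm (M alpha - M beta) ->
     with_prob_ge P (q alpha * q beta)
       [set om | exists i j,
          [/\ i \in I alpha om, j \in I beta om & X i om <> X j om]]).
Proof.
move=> I N q; split; first exact: (same_cluster_prob model sigma_gt0 graph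
  (ltW gamma1_gt0) (ltW gamma2_gt0) X_sol t (ltW eps_gt0) alpha).
move=> beta beta_alpha q_ge0 sep.
apply: (different_cluster_prob model sigma_gt0 graph (ltW gamma1_gt0)
  (ltW gamma2_gt0) X_sol (ltW eps_gt0)) => //.
by rewrite eq_sym.
Qed.
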